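(* For all positive integers $m$ and $p$, $$2\sum_{n=1}^\infty\frac{T_n(\{1\}_{2m-2})\,T_n(\{1\}_{2p-2})}{2n-1}(-1)^n=(-1)^{m-1}\sum_{j=1}^pW(2j+2m-3,2m-1)\,Z(j,p).$$
   Context: $\{1\}_a$ denotes the sequence of $a$ ones. $T_n(\emptyset):=1$, and for $n\ge1$, $a\ge1$: $T_n(\{1\}_{2a})=\sum\frac{2^{2a}}{\prod_{i=1}^a(2n_{2i-1}-1)(2n_{2i})}$, summed over integers $0<n_1\le n_2<n_3\le n_4<\cdots<n_{2a-1}\le n_{2a}<n$ (empty sum $=0$). For positive integers $k_1,\dots,k_r$, $\bar T(k_1,\ldots,k_r):=2^r\sum_{0<n_1<\cdots<n_r}\frac{(-1)^{n_r}}{(2n_1-1)^{k_1}(2n_2-2)^{k_2}\cdots(2n_r-r)^{k_r}}$. $I(k,r)$ is the set of tuples of positive integers $(k_1,\dots,k_r)$ with sum $k$; $W(k,r):=\sum_{(k_1,\dots,k_r)\in I(k,r)}\bar T(k_1,\dots,k_r)$. $\bar\zeta(s):=\sum_{n\ge1}(-1)^{n-1}n^{-s}$ for $s\ge1$, $\bar\zeta(0):=1/2$. For $1\le j\le p$: $Z(p,p):=1$ and for $j<p$, $Z(j,p):=\sum_{k=1}^{p-j}(-2)^k\sum_{j=i_0<i_1<\cdots<i_k=p}\prod_{l=1}^k\bar\zeta(2i_l-2i_{l-1})$. *)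

(* Defs.v *)
From Stdlib Require Import Reals List Arith Bool.
From Coquelicot Require Import Coquelicot.
Import ListNotations.
Open Scope R_scope.

Definition lsum (l : list R) : R := fold_right Rplus 0 l.

(* sum_{n = a}^{b} f n  (empty, i.e. 0, when b < a) *)
Definition fsum (a b : nat) (f : nat -> R) : R :=
  lsum (map f (seq a (S b - a))).

Fixpoint all_lists (r k : nat) : list (list nat) :=
  match r with
  | O => [nil]
  | S r' => flat_map (fun x => map (cons x) (all_lists r' k)) (seq 1 k)
  end.

Definition nsum (l : list nat) : nat := fold_right Nat.add 0%nat l.

Fixpoint incr (l : list nat) : bool :=
  match l with
  | a :: ((b :: _) as t) => andb (Nat.ltb a b) (incr t)
  | _ => true
  end.

Fixpoint prod_diffs (f : nat -> R) (l : list nat) : R :=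
  match l with
  | a :: ((b :: _) as t) => f (b - a)%nat * prod_diffs f t
  | _ => 1
  end.

(* Tsum a N = T_N({1}_{2a}) =
   sum over 0<n1<=n2<n3<=...<n_{2a-1}<=n_{2a}<N of
   2^{2a} / prod_{i=1}^a (2 n_{2i-1} - 1)(2 n_{2i});  Tsum 0 N = 1. *)
Fixpoint Tsum (a N : nat) : R :=
  match a with
  | O => 1
  | S a' =>
      fsum 1 (N - 1) (fun u =>
        fsum u (N - 1) (fun v =>
          Tsum a' u * 4 / ((2 * INR u - 1) * (2 * INR v))))
  end.

(* Grev [k_i; k_{i-1}; ...; k_1] N =
   sum over 0<n1<...<n_i<N of prod_{l=1}^i 1/(2 n_l - l)^{k_l} *)
Fixpoint Grev (rks : list nat) (N : nat) : R :=
  match rks with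
  | nil => 1
  | k :: rest =>
      fsum 1 (N - 1) (fun n =>
        Grev rest n / (2 * INR n - INR (length rks)) ^ k)
  end.

(* \bar T(k_1,...,k_r) = 2^r sum_{0<n1<...<nr} (-1)^{n_r} / prod (2n_i - i)^{k_i},
   the outer summation being over n_r (series in n_r). *)
Definition barT (ks : list nat) : R :=
  match rev ks with
  | nil => 1
  | k :: rest =>
      2 ^ length ks *
      Series (fun N0 => let N := S N0 in
        (-1) ^ N / (2 * INR N - INR (length ks)) ^ k * Grev rest N)
  end.

Definition W (k r : nat) : R :=
  lsum (map barT (filter (fun ks => Nat.eqb (nsum ks) k) (all_lists r k))).

Definition zetabar (s : nat) : R :=
  match s with
  | O => 1 / 2
  | _ => Series (fun n => (-1) ^ n / (INR (S n)) ^ s)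
  end.

Definition Zc (j p : nat) : R :=
  if Nat.eqb j p then 1 else
  fsum 1 (p - j) (fun k =>
    (-2) ^ k *
    lsum (map (fun l => prod_diffs (fun d => zetabar (2 * d)) (j :: l))
      (filter (fun l => andb (incr (j :: l)) (Nat.eqb (last l j) p))
              (all_lists k p)))).

(* Main.v *)
Require Import Defs.
From Stdlib Require Import Reals List Arith Lra Lia Permutation.
From Coquelicot Require Import Coquelicot.
Import ListNotations.
Open Scope R_scope.

(* Put [v = (1 - u) / (1 + u)] and consider moments over [0, 1] with weight [(- ln u)^s / s!].

   Integrating by parts, the moments of [2 v^N / (1 + u)^2] satisfy the recursion of the sums
   [parity_chain N k] over chains [m_1 < ... < m_k <= N] of alternating parity, which for
   [N = 2 n - 2] and [k = 2 b] are the [T_n({1}_{2b})]. Hence [(2 n - 1)] times the moment with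
   [s = 2 q] equals [sum_b T_n({1}_{2b}) * 2 zetabar(2q - 2b)], and the matrix [Z(j, p)] inverts
   this convolution. The same chains are, up to sign, the coefficients of [v^N] in
   [(2 atan v)^k / k! / (1 + v^2)]. So the left-hand side of the theorem is the combination with
   coefficients [Z(j, p)] of the moments, with [s = 2 j - 2], of
   [(2 atan v)^(2m-2) / (2m-2)! / (1 + u^2)].

   Since the derivative of [2 atan v] with respect to [u] is [- 2 / (1 + u^2)], expanding
   [1 / (1 + u^2)] in powers of [u] and integrating by parts repeatedly turns the [j]-th of these
   moments into the sum defining [W(2j + 2m - 3, 2m - 1)]. *)

Local Arguments seq : simpl never.

(** * Finite sums and convolutions *)

Lemma lsum_app l l' : lsum (l ++ l') = lsum l + lsum l'.
Proof. induction l as [|x l IH]; simpl; [|rewrite IH]; ring. Qed.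

Lemma lsum_permutation l l' : Permutation l l' -> lsum l = lsum l'.
Proof. induction 1; simpl; lra. Qed.

Section ListSums.

Context {A : Type}.
Implicit Types (f g : A -> R) (l : list A).

Lemma lsum_ext_in f g l : (forall x, In x l -> f x = g x) -> lsum (map f l) = lsum (map g l).
Proof. intros H. f_equal. now apply map_ext_in. Qed.

Lemma lsum_eq_0 f l : (forall x, In x l -> f x = 0) -> lsum (map f l) = 0.
Proof.
  induction l as [|x l IH]; simpl; intros H; [reflexivity|].
  rewrite H, IH by auto. ring.
Qed.

Lemma lsum_plus f g l : lsum (map (fun x => f x + g x) l) = lsum (map f l) + lsum (map g l).
Proof. induction l as [|x l IH]; simpl; [|rewrite IH]; ring. Qed.

Lemma lsum_scal c f l : lsum (map (fun x => c * f x) l) = c * lsum (map f l).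
Proof. induction l as [|x l IH]; simpl; [|rewrite IH]; ring. Qed.

Lemma lsum_filter f (P : A -> bool) l :
  lsum (map f (filter P l)) = lsum (map (fun x => if P x then f x else 0) l).
Proof.
  induction l as [|x l IH]; simpl; [reflexivity|].
  destruct (P x); simpl; rewrite IH; ring.
Qed.

End ListSums.

Lemma lsum_swap {A B : Type} (f : A -> B -> R) l l' :
  lsum (map (fun x => lsum (map (f x) l')) l) =
  lsum (map (fun y => lsum (map (fun x => f x y) l)) l').
Proof.
  induction l as [|x l IH]; simpl.
  - symmetry. now apply lsum_eq_0.
  - now rewrite IH, <- lsum_plus.
Qed.

Lemma lsum_flat_map {A B : Type} (f : B -> R) (g : A -> list B) l :
  lsum (map f (flat_map g l)) = lsum (map (fun x => lsum (map f (g x))) l).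
Proof.
  induction l as [|x l IH]; simpl; [reflexivity|].
  now rewrite map_app, lsum_app, IH.
Qed.

Local Notation rsum n f := (lsum (map f (seq 0 n))).

Lemma rsum_ext n f g : (forall i, (i < n)%nat -> f i = g i) -> rsum n f = rsum n g.
Proof. intros H. apply lsum_ext_in. intros i Hi. apply H. apply in_seq in Hi. lia. Qed.

Lemma rsum_eq_0 n f : (forall i, (i < n)%nat -> f i = 0) -> rsum n f = 0.
Proof. intros H. apply lsum_eq_0. intros i Hi. apply H. apply in_seq in Hi. lia. Qed.

Lemma rsum_0 f : rsum 0 f = 0.
Proof. reflexivity. Qed.

Lemma rsum_S n f : rsum (S n) f = rsum n f + f n.
Proof. rewrite seq_S, map_app, lsum_app. simpl. ring. Qed.

Lemma rsum_add n m f : rsum (n + m) f = rsum n f + rsum m (fun i => f (n + i)%nat).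
Proof.
  induction m as [|m IH].
  - rewrite Nat.add_0_r, rsum_0. ring.
  - rewrite Nat.add_succ_r, !rsum_S, IH. ring.
Qed.

Lemma rsum_S_l n f : rsum (S n) f = f 0%nat + rsum n (fun i => f (S i)).
Proof. rewrite (rsum_add 1 n), rsum_S, rsum_0, Rplus_0_l. reflexivity. Qed.

Lemma rsum_truncate n m f : (m <= n)%nat -> (forall i, (m <= i < n)%nat -> f i = 0) ->
  rsum n f = rsum m f.
Proof.
  intros Hm H. replace n with (m + (n - m))%nat by lia. rewrite rsum_add.
  rewrite (rsum_eq_0 (n - m)); [ring|]. intros i Hi. apply H. lia.
Qed.

Lemma rsum_indicator n c f : (c < n)%nat ->
  rsum n (fun i => if Nat.eqb c i then f i else 0) = f c.
Proof.
  intros Hc. rewrite (rsum_truncate n (S c)); [|lia|].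
  - rewrite rsum_S, Nat.eqb_refl, rsum_eq_0; [ring|].
    intros i Hi. destruct (Nat.eqb_spec c i); [lia|reflexivity].
  - intros i Hi. destruct (Nat.eqb_spec c i); [lia|reflexivity].
Qed.

Lemma rsum_even_support n f : (forall i, f (S (2 * i)) = 0) ->
  rsum (S (2 * n)) f = rsum (S n) (fun i => f (2 * i)%nat).
Proof.
  intros H. induction n as [|n IH]; [reflexivity|].
  replace (2 * S n)%nat with (S (S (2 * n))) by lia.
  rewrite rsum_S, rsum_S, IH, H, (rsum_S (S n)).
  replace (2 * S n)%nat with (S (S (2 * n))) by lia. ring.
Qed.

Lemma rsum_rev n f : rsum n (fun i => f (n - S i)%nat) = rsum n f.
Proof.
  induction n as [|n IH]; [reflexivity|].
  rewrite rsum_S_l, rsum_S, Rplus_comm. f_equal; [exact IH|f_equal; lia].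
Qed.

Lemma rsum_triangle s (f : nat -> nat -> R) :
  rsum (S s) (fun t => rsum (S t) (f t)) =
  rsum (S s) (fun j => rsum (S (s - j)) (fun i => f (j + i)%nat j)).
Proof.
  induction s as [|s IH]; [reflexivity|].
  rewrite (rsum_S (S s)), IH, (rsum_S (S s) (f (S s))), <- Rplus_assoc, <- lsum_plus.
  rewrite (rsum_S (S s) (fun j => rsum (S (S s - j)) _)), Nat.sub_diag, (rsum_S 0), rsum_0.
  rewrite Rplus_0_l, Nat.add_0_r. f_equal. apply rsum_ext. intros j Hj.
  replace (S s - j)%nat with (S (s - j)) by lia. rewrite (rsum_S (S (s - j))).
  f_equal. f_equal. lia.
Qed.

Lemma fsum_rsum a b f : fsum a b f = rsum (S b - a) (fun i => f (a + i)%nat).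
Proof.
  unfold fsum. generalize (S b - a)%nat. intros n.
  induction n as [|n IH]; [reflexivity|].
  now rewrite rsum_S, seq_S, map_app, lsum_app, IH; simpl; rewrite Rplus_0_r.
Qed.

Definition conv (a b : nat -> R) (s : nat) : R := rsum (S s) (fun t => a t * b (s - t)%nat).

Lemma conv_ext a a' b b' s : (forall t, a t = a' t) -> (forall t, b t = b' t) ->
  conv a b s = conv a' b' s.
Proof. intros Ha Hb. apply rsum_ext. intros t _. now rewrite Ha, Hb. Qed.

Lemma conv_comm a b s : conv a b s = conv b a s.
Proof.
  unfold conv. rewrite <- rsum_rev. apply rsum_ext. intros t Ht.
  rewrite Rmult_comm. f_equal; f_equal; lia.
Qed.

Lemma conv_assoc a b c s : conv (conv a b) c s = conv a (conv b c) s.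
Proof.
  transitivity (rsum (S s) (fun t => rsum (S t) (fun j => a j * b (t - j)%nat * c (s - t)%nat))).
  { apply rsum_ext. intros t _. unfold conv. rewrite Rmult_comm, <- lsum_scal.
    apply rsum_ext. intros; ring. }
  rewrite (rsum_triangle s (fun t j => a j * b (t - j)%nat * c (s - t)%nat)).
  apply rsum_ext. intros j Hj. unfold conv. rewrite <- lsum_scal. apply rsum_ext.
  intros i Hi. replace (j + i - j)%nat with i by lia.
  replace (s - (j + i))%nat with (s - j - i)%nat by lia. ring.
Qed.

Lemma conv_plus_l a a' b s : conv (fun t => a t + a' t) b s = conv a b s + conv a' b s.
Proof. unfold conv. rewrite <- lsum_plus. apply rsum_ext; intros; ring. Qed.

Lemma conv_plus_r a b b' s : conv a (fun t => b t + b' t) s = conv a b s + conv a b' s.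
Proof. unfold conv. rewrite <- lsum_plus. apply rsum_ext; intros; ring. Qed.

Lemma conv_scal_r a b c s : conv a (fun t => c * b t) s = c * conv a b s.
Proof. unfold conv. rewrite <- lsum_scal. apply rsum_ext; intros; ring. Qed.

Lemma conv_0_l a b s : (forall t, a t = 0) -> conv a b s = 0.
Proof. intros H. apply rsum_eq_0. intros t _. rewrite H. ring. Qed.

(** * Series *)

Lemma is_series_rsum (f : nat -> R) (l : R) : is_series f l <-> is_lim_seq (fun n => rsum n f) l.
Proof.
  assert (E : forall n, sum_n f n = rsum (S n) f).
  { induction n as [|n IH]; [rewrite sum_O, rsum_S, rsum_0; symmetry; apply Rplus_0_l|].
    rewrite sum_Sn, IH, (rsum_S (S n)). reflexivity. }
  split; intros H.
  - apply is_lim_seq_incr_1. now apply (is_lim_seq_ext (sum_n f)).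
  - apply is_lim_seq_incr_1 in H. now apply (is_lim_seq_ext _ (sum_n f)) in H.
Qed.

Lemma is_series_Rext (a b : nat -> R) (l : R) : (forall n, a n = b n) ->
  is_series a l -> is_series b l.
Proof. exact (is_series_ext a b l). Qed.

Lemma is_series_Rscal (c : R) (a : nat -> R) (l : R) :
  is_series a l -> is_series (fun n => c * a n) (c * l).
Proof. exact (is_series_scal (K := R_AbsRing) (V := R_NormedModule) c a l). Qed.

Lemma is_series_lsum {A : Type} (f : A -> nat -> R) (s : A -> R) l :
  (forall x, In x l -> is_series (f x) (s x)) ->
  is_series (fun n => lsum (map (fun x => f x n) l)) (lsum (map s l)).
Proof.
  induction l as [|x l IH]; intros H.
  - apply is_series_rsum. apply (is_lim_seq_ext (fun _ => 0)); [|apply is_lim_seq_const].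
    intros n. symmetry. now apply rsum_eq_0.
  - apply (is_series_plus (K := R_AbsRing) (V := R_NormedModule)); [|apply IH; intros];
      apply H; simpl; auto.
Qed.

Lemma is_series_leading_zeros a (f : nat -> R) (l : R) : (forall i, (i < a)%nat -> f i = 0) ->
  is_series (fun i => f (a + i)%nat) l -> is_series f l.
Proof.
  intros Hzero H. apply is_series_rsum in H. apply is_series_rsum, (is_lim_seq_incr_n _ a).
  revert H. apply is_lim_seq_ext. intros n.
  rewrite Nat.add_comm, rsum_add, (rsum_eq_0 a) by easy. ring.
Qed.

Lemma is_lim_seq_dist_le (u e : nat -> R) (l : R) : (forall n, Rabs (u n - l) <= e n) ->
  is_lim_seq e 0 -> is_lim_seq u l.
Proof.
  intros H He.
  assert (Hd : is_lim_seq (fun n => u n - l) 0).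
  { apply is_lim_seq_abs_0, (is_lim_seq_le_le (fun _ => 0) _ e); auto using is_lim_seq_const.
    intros n. split; [apply Rabs_pos|apply H]. }
  apply (is_lim_seq_ext (fun n => u n - l + l)); [intros; ring|].
  replace (Finite l) with (Finite (0 + l)) by (f_equal; ring).
  apply is_lim_seq_plus'; [easy|apply is_lim_seq_const].
Qed.

Lemma is_series_alternating_telescope b : is_lim_seq b 0 ->
  is_series (fun n => (-1) ^ n * (b n + b (S n))) (b 0%nat).
Proof.
  intros Hb. apply is_series_rsum, (is_lim_seq_dist_le _ (fun n => Rabs (b n))).
  - intros n.
    assert (E : rsum n (fun n => (-1) ^ n * (b n + b (S n))) = b 0%nat - (-1) ^ n * b n).
    { induction n as [|n IH]; [rewrite rsum_0|rewrite rsum_S, IH]; simpl; ring. }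
    rewrite E. replace (_ - _ - _) with (- ((-1) ^ n * b n)) by ring.
    rewrite Rabs_Ropp, Rabs_mult, pow_1_abs. lra.
  - now apply is_lim_seq_abs_0 in Hb.
Qed.

Lemma ex_series_alternating b : is_lim_seq b 0 ->
  ex_series (fun n => Rabs (b n - b (S n))) -> ex_series (fun n => (-1) ^ n * b n).
Proof.
  intros Hb Hd.
  assert (H : ex_series (fun n => (-1) ^ n * (b n - b (S n)))).
  { apply ex_series_Rabs. revert Hd. apply ex_series_ext. intros n.
    rewrite Rabs_mult, pow_1_abs. symmetry. apply Rmult_1_l. }
  destruct H as [s Hs]. exists (/ 2 * (s + b 0%nat)).
  apply (is_series_Rext (fun n => / 2 *
    ((-1) ^ n * (b n - b (S n)) + (-1) ^ n * (b n + b (S n))))).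
  - intros n. field.
  - apply is_series_Rscal, (is_series_plus (K := R_AbsRing) (V := R_NormedModule)); [easy|].
    now apply is_series_alternating_telescope.
Qed.

(** * Logarithmic growth *)

Definition plog (n : nat) : R := 1 + ln (INR n + 1).

Lemma plog_ge_1 n : 1 <= plog n.
Proof.
  unfold plog. assert (0 <= ln (INR n + 1)); [|lra].
  rewrite <- ln_1. apply ln_le; [lra|]. pose proof (pos_INR n); lra.
Qed.

Lemma plog_pow_ge_1 n r : 1 <= plog n ^ r.
Proof. apply pow_R1_Rle, plog_ge_1. Qed.

Lemma plog_le_S n : plog n <= plog (S n).
Proof.
  unfold plog. apply Rplus_le_compat_l, ln_le; rewrite ?S_INR; pose proof (pos_INR n); lra.
Qed.

Lemma plog_increment_ge n : / (INR n + 1) <= 2 * (plog (S n) - plog n).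
Proof.
  unfold plog. rewrite S_INR. pose proof (pos_INR n) as Hn.
  set (x := (INR n + 1) / (INR n + 2)).
  assert (Hx : 0 < x) by (apply Rdiv_lt_0_compat; lra).
  pose proof (exp_ineq1_le (ln x)) as H. rewrite exp_ln in H by exact Hx.
  unfold x in H. rewrite ln_div in H by lra.
  replace (INR n + 1 + 1) with (INR n + 2) by ring.
  assert (E : / (INR n + 1) <= 2 * (1 - (INR n + 1) / (INR n + 2))); [|lra].
  apply Rmult_le_reg_r with ((INR n + 1) * (INR n + 2)); [nra|]. field_simplify; lra.
Qed.

Lemma pow_le_exp n x : (1 <= n)%nat -> 0 <= x -> x ^ n <= INR n ^ n * exp x.
Proof.
  intros Hn Hx. assert (0 < INR n) by (apply lt_0_INR; lia).
  assert (E : exp x = exp (x / INR n) ^ n).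
  { rewrite <- Rpower_pow by apply exp_pos. unfold Rpower. rewrite ln_exp. f_equal. field. lra. }
  rewrite E, <- Rpow_mult_distr. apply pow_incr. split; [easy|].
  pose proof (exp_ineq1_le (x / INR n)).
  apply Rle_trans with (INR n * (x / INR n)); [right; field; lra|].
  apply Rmult_le_compat_l; lra.
Qed.

Lemma plog_pow_le_linear r : exists K, 0 < K /\ forall n, plog n ^ r <= K * (INR n + 1).
Proof.
  exists (INR (S r) ^ S r * exp 1). split.
  - apply Rmult_lt_0_compat; [apply pow_lt, lt_0_INR; lia|apply exp_pos].
  - intros n. pose proof (plog_ge_1 n). pose proof (pos_INR n).
    apply Rle_trans with (plog n ^ S r); [apply Rle_pow; [easy|lia]|].
    eapply Rle_trans; [apply pow_le_exp; [lia|lra]|].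
    unfold plog. rewrite exp_plus, exp_ln by lra. lra.
Qed.

Lemma is_lim_seq_plog : is_lim_seq plog p_infty.
Proof.
  apply (is_lim_seq_plus _ _ 1 p_infty); [apply is_lim_seq_const| |reflexivity].
  apply (is_lim_comp_seq ln _ p_infty p_infty); [apply is_lim_ln_p| |].
  - exists 0%nat. intros n _. discriminate.
  - apply (is_lim_seq_plus _ _ p_infty 1);
      [apply is_lim_seq_INR|apply is_lim_seq_const|reflexivity].
Qed.

Definition log_growth (f : nat -> R) : Prop :=
  exists C r, 0 <= C /\ forall n, Rabs (f n) <= C * plog n ^ r.

Lemma log_growth_const c : log_growth (fun _ => c).
Proof.
  exists (Rabs c), 0%nat. split; [apply Rabs_pos|]. intros n. simpl. lra.
Qed.

Lemma log_growth_le f g : log_growth g -> (forall n, Rabs (f n) <= Rabs (g n)) -> log_growth f.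
Proof.
  intros [C [r [HC H]]] Hf. exists C, r. split; [easy|].
  intros n. eapply Rle_trans; eauto.
Qed.

Lemma log_growth_ext f g : (forall n, f n = g n) -> log_growth f -> log_growth g.
Proof. intros E H. apply (log_growth_le _ f); [easy|]. intros n. rewrite E. lra. Qed.

Lemma log_growth_abs f : log_growth f -> log_growth (fun n => Rabs (f n)).
Proof. intros H. apply (log_growth_le _ f); [easy|]. intros n. rewrite Rabs_Rabsolu. lra. Qed.

Lemma log_growth_plus f g : log_growth f -> log_growth g -> log_growth (fun n => f n + g n).
Proof.
  intros [C [r [HC Hf]]] [C' [r' [HC' Hg]]]. exists (C + C'), (r + r')%nat.
  split; [lra|]. intros n. eapply Rle_trans; [apply Rabs_triang|].
  rewrite Rmult_plus_distr_r. pose proof (plog_ge_1 n).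
  apply Rplus_le_compat; (eapply Rle_trans; [auto|]);
    apply Rmult_le_compat_l, Rle_pow; auto; lia.
Qed.

Lemma log_growth_mult f g : log_growth f -> log_growth g -> log_growth (fun n => f n * g n).
Proof.
  intros [C [r [HC Hf]]] [C' [r' [HC' Hg]]]. exists (C * C'), (r + r')%nat.
  split; [now apply Rmult_le_pos|]. intros n. rewrite Rabs_mult, pow_add.
  replace (C * C' * _) with ((C * plog n ^ r) * (C' * plog n ^ r')) by ring.
  apply Rmult_le_compat; auto using Rabs_pos.
Qed.

Lemma log_growth_lsum {A : Type} (f : A -> nat -> R) l : (forall x, In x l -> log_growth (f x)) ->
  log_growth (fun n => lsum (map (fun x => f x n) l)).
Proof.
  induction l; simpl; intros H; [apply log_growth_const|]. apply log_growth_plus; auto.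
Qed.

Lemma log_growth_of_eventually_bounded f M : eventually (fun n => Rabs (f n) <= M) -> log_growth f.
Proof.
  intros [N HN]. revert M HN. induction N as [|N IH]; intros M HN.
  - apply (log_growth_le _ (fun _ => M)); [apply log_growth_const|]. intros n.
    eapply Rle_trans; [apply HN; lia|apply Rle_abs].
  - apply (IH (Rmax M (Rabs (f N)))). intros n Hn.
    destruct (Nat.eq_dec n N) as [->|Hne]; [apply Rmax_r|].
    eapply Rle_trans; [apply HN; lia|apply Rmax_l].
Qed.

Lemma log_growth_inv_INR_1 : log_growth (fun n => / (INR n + 1)).
Proof.
  apply (log_growth_of_eventually_bounded _ 1). exists 0%nat. intros n _. pose proof (pos_INR n).
  rewrite Rabs_pos_eq by (left; apply Rinv_0_lt_compat; lra).
  rewrite <- Rinv_1. apply Rinv_le_contravar; lra.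
Qed.

Lemma log_growth_partial_sums f : log_growth (fun n => (INR n + 1) * f n) ->
  log_growth (fun n => rsum n f).
Proof.
  intros [C [r [HC H]]]. exists (2 * C), (S r). split; [lra|].
  assert (Hpow : forall n, 0 <= 2 * C * plog n ^ r).
  { intros n. pose proof (plog_pow_ge_1 n r). apply Rmult_le_pos; lra. }
  assert (Hsum : forall n, Rabs (rsum n f) <= 2 * C * plog n ^ r * (plog n - 1)).
  { induction n as [|n IH].
    - rewrite rsum_0, Rabs_R0. apply Rmult_le_pos; [easy|]. pose proof (plog_ge_1 0). lra.
    - rewrite rsum_S. eapply Rle_trans; [apply Rabs_triang|].
      apply Rle_trans with (2 * C * plog n ^ r * (plog (S n) - 1)).
      + assert (Hf : Rabs (f n) <= C * plog n ^ r * (2 * (plog (S n) - plog n))); [|lra].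
        pose proof (pos_INR n). specialize (H n).
        rewrite Rabs_mult, (Rabs_pos_eq (INR n + 1)) in H by lra.
        apply Rle_trans with (C * plog n ^ r * / (INR n + 1)).
        * apply Rmult_le_reg_l with (INR n + 1); [lra|]. field_simplify; lra.
        * apply Rmult_le_compat_l; [specialize (Hpow n); lra|apply plog_increment_ge].
      + pose proof (plog_ge_1 (S n)). pose proof (plog_ge_1 n).
        apply Rmult_le_compat_r, Rmult_le_compat_l, pow_incr; [lra..|].
        pose proof (plog_le_S n). lra. }
  intros n. eapply Rle_trans; [apply Hsum|]. specialize (Hpow n). simpl. nra.
Qed.

Lemma log_growth_div_lim f : log_growth f -> is_lim_seq (fun n => f n / (INR n + 1)) 0.
Proof.
  intros [C [r [HC H]]]. destruct (plog_pow_le_linear (S r)) as [K [HK HL]].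
  apply (is_lim_seq_dist_le _ (fun n => C * K * / plog n)).
  - intros n. rewrite Rminus_0_r. pose proof (pos_INR n). pose proof (plog_ge_1 n).
    unfold Rdiv. rewrite Rabs_mult, (Rabs_pos_eq (/ _)) by (left; apply Rinv_0_lt_compat; lra).
    apply Rmult_le_reg_r with ((INR n + 1) * plog n); [apply Rmult_lt_0_compat; lra|].
    apply Rle_trans with (C * plog n ^ S r).
    + specialize (H n). simpl. field_simplify; [|lra]. nra.
    + specialize (HL n). field_simplify; [|lra]. nra.
  - replace (Finite 0) with (Rbar_mult (C * K) 0) by (simpl; f_equal; ring).
    apply is_lim_seq_scal_l, (is_lim_seq_inv _ _ is_lim_seq_plog). discriminate.
Qed.

Lemma ex_series_of_increments f b : (forall n, 0 <= b n) ->
  (forall n, 0 <= f n <= b n - b (S n)) -> ex_series f.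
Proof.
  intros Hb Hf.
  destruct (ex_finite_lim_seq_incr (fun n => rsum n f) (b 0%nat)) as [s Hs].
  - intros n. rewrite rsum_S. specialize (Hf n). lra.
  - assert (Hle : forall n, rsum n f <= b 0%nat - b n).
    { induction n as [|n IH]; [rewrite rsum_0; lra|]. rewrite rsum_S. specialize (Hf n). lra. }
    intros n. specialize (Hle n). specialize (Hb n). lra.
  - exists s. now apply is_series_rsum.
Qed.

Lemma ex_series_inv_pow_3_2 : ex_series (fun n => / ((INR n + 1) * sqrt (INR n + 1))).
Proof.
  apply (ex_series_of_increments _ (fun n => 4 * / sqrt (INR n + 1))); intros n;
    pose proof (pos_INR n) as Hn; assert (0 < sqrt (INR n + 1)) by (apply sqrt_lt_R0; lra).
  - apply Rmult_le_pos; [lra|]. left. now apply Rinv_0_lt_compat.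
  - rewrite S_INR. set (a := sqrt (INR n + 1)) in *. set (b := sqrt (INR n + 1 + 1)).
    assert (Ha : a * a = INR n + 1) by (apply sqrt_sqrt; lra).
    assert (Hb : b * b = INR n + 1 + 1) by (apply sqrt_sqrt; lra).
    assert (a <= b) by (apply sqrt_le_1_alt; lra).
    rewrite <- Ha. split; [left; apply Rinv_0_lt_compat; nra|].
    replace (4 * / a - 4 * / b) with (4 * (b * b - a * a) * / (a * b * (a + b)))
      by (field; repeat split; nra).
    replace (4 * (b * b - a * a)) with 4 by lra.
    assert (Hab : a * b * (a + b) <= 4 * (a * a * a)).
    { assert (b * (a + b) <= 4 * (a * a)) by nra. nra. }
    assert (0 < a * b * (a + b)) by (repeat apply Rmult_lt_0_compat; lra).
    apply Rmult_le_reg_r with (a * a * a * (a * b * (a + b))); [apply Rmult_lt_0_compat; nra|].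
    field_simplify; [|repeat split; lra..]. lra.
Qed.

Lemma log_growth_ex_series f : log_growth (fun n => (INR n + 1) ^ 2 * f n) ->
  ex_series (fun n => Rabs (f n)).
Proof.
  intros [C [r [HC H]]]. destruct (plog_pow_le_linear (r + r)) as [K [HK HL]].
  apply (@ex_series_le R_AbsRing R_CompleteNormedModule _
    (fun n => C * sqrt K * / ((INR n + 1) * sqrt (INR n + 1)))).
  - intros n. change (norm (Rabs (f n))) with (Rabs (Rabs (f n))). rewrite Rabs_Rabsolu.
    pose proof (pos_INR n). set (q := sqrt (INR n + 1)).
    assert (Hq : 0 < q) by (apply sqrt_lt_R0; lra).
    assert (Hq2 : q * q = INR n + 1) by (apply sqrt_sqrt; lra).
    assert (HLr : plog n ^ r <= sqrt K * q).
    { unfold q. rewrite <- sqrt_mult by lra. apply Rsqr_incr_0_var; [|apply sqrt_pos].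
      unfold Rsqr. rewrite sqrt_sqrt by nra. rewrite <- pow_add. apply HL. }
    specialize (H n). rewrite Rabs_mult, (Rabs_pos_eq (_ ^ 2)) in H by apply pow2_ge_0.
    apply Rmult_le_reg_l with ((INR n + 1) ^ 2); [apply pow_lt; lra|].
    apply Rle_trans with (C * (sqrt K * q)).
    + eapply Rle_trans; [exact H|]. now apply Rmult_le_compat_l.
    + right. rewrite <- Hq2. field. lra.
  - apply (@ex_series_scal R_AbsRing R_NormedModule (C * sqrt K)), ex_series_inv_pow_3_2.
Qed.

(* The truncated sums [Grev] carry no monotonicity to feed Leibniz's criterion; what survives
   products and partial sums is this control on the increments. *)
Definition log_regular (f : nat -> R) : Prop :=
  log_growth f /\ log_growth (fun n => (INR n + 1) * (f (S n) - f n)).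

Lemma log_regular_log_growth f : log_regular f -> log_growth f.
Proof. now intros []. Qed.

Lemma log_regular_ext f g : (forall n, f n = g n) ->
  log_regular f -> log_regular g.
Proof.
  intros E [Hf Hdf]. split; [now apply (log_growth_ext f)|].
  revert Hdf. apply log_growth_ext. intros n. now rewrite !E.
Qed.

Lemma log_regular_const c : log_regular (fun _ => c).
Proof.
  split; [apply log_growth_const|]. apply (log_growth_ext (fun _ => 0)); [|apply log_growth_const].
  intros n. ring.
Qed.

Lemma log_regular_mult f g : log_regular f -> log_regular g ->
  log_regular (fun n => f n * g n).
Proof.
  intros [Hf Hdf] [Hg Hdg]. split; [now apply log_growth_mult|].
  assert (HfS : log_growth (fun n => f (S n))).
  { apply (log_growth_ext (fun n => f n + / (INR n + 1) * ((INR n + 1) * (f (S n) - f n)))).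
    - intros n. pose proof (pos_INR n). field. lra.
    - auto using log_growth_plus, log_growth_mult, log_growth_inv_INR_1. }
  apply (log_growth_ext (fun n => f (S n) * ((INR n + 1) * (g (S n) - g n)) +
    (INR n + 1) * (f (S n) - f n) * g n)); [intros; ring|].
  auto using log_growth_plus, log_growth_mult.
Qed.

Lemma log_regular_pow f k : log_regular f -> log_regular (fun n => f n ^ k).
Proof.
  intros H. induction k; simpl; [apply log_regular_const|now apply log_regular_mult].
Qed.

Lemma log_regular_partial_sums f : log_growth (fun n => (INR n + 1) * f n) ->
  log_regular (fun n => rsum n f).
Proof.
  intros H. split; [now apply log_growth_partial_sums|].
  apply (log_growth_ext (fun n => (INR n + 1) * f n)); [|easy]. intros n. rewrite rsum_S. ring.
Qed.

Lemma log_regular_ex_series f : log_regular f ->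
  ex_series (fun n => (-1) ^ n * (f n / (INR n + 1))).
Proof.
  intros [Hf Hdf]. apply ex_series_alternating; [now apply log_growth_div_lim|].
  apply log_growth_ex_series.
  apply (log_growth_ext (fun n => (1 + -1 * / (INR (S n) + 1)) *
    (f n + -1 * ((INR n + 1) * (f (S n) - f n))))).
  - intros n. rewrite S_INR. pose proof (pos_INR n). field. lra.
  - apply log_growth_mult; apply log_growth_plus; auto using log_growth_mult, log_growth_const.
    apply log_growth_mult; [apply log_growth_const|].
    apply (log_growth_le _ _ log_growth_inv_INR_1). intros n. pose proof (pos_INR n). rewrite S_INR.
    rewrite !Rabs_pos_eq by (left; apply Rinv_0_lt_compat; lra).
    apply Rinv_le_contravar; lra.
Qed.

Lemma eventually_INR_1_le_shift c : eventually (fun n => INR n + 1 <= 2 * INR n + 1 - c).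
Proof.
  destruct (INR_unbounded c) as [N HN]. exists N. intros n Hn. apply le_INR in Hn. lra.
Qed.

(* Division by zero at [2 n + 1 = c] affects a single term only. *)
Lemma log_regular_inv_shift c : log_regular (fun n => / (2 * INR n + 1 - c)).
Proof.
  destruct (eventually_INR_1_le_shift c) as [N HN]. split.
  - apply (log_growth_of_eventually_bounded _ 1). exists N. intros n Hn. specialize (HN n Hn).
    pose proof (pos_INR n). rewrite Rabs_pos_eq by (left; apply Rinv_0_lt_compat; lra).
    rewrite <- Rinv_1. apply Rinv_le_contravar; lra.
  - apply (log_growth_of_eventually_bounded _ 2). exists N. intros n Hn. specialize (HN n Hn).
    pose proof (pos_INR n). rewrite S_INR. set (x := 2 * INR n + 1 - c) in *.
    replace (2 * (INR n + 1) + 1 - c) with (x + 2) by (unfold x; ring).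
    replace ((INR n + 1) * (/ (x + 2) - / x)) with (- (2 * (INR n + 1) / (x * (x + 2))))
      by (field; lra).
    rewrite Rabs_Ropp, Rabs_pos_eq by (apply Rdiv_le_0_compat; nra).
    apply Rmult_le_reg_r with (x * (x + 2)); [nra|]. field_simplify; [nra|lra].
Qed.

Lemma log_regular_ratio_shift c :
  log_regular (fun n => (INR n + 1) * / (2 * INR n + 1 - c)).
Proof.
  destruct (eventually_INR_1_le_shift c) as [N HN]. split.
  - apply (log_growth_of_eventually_bounded _ 1). exists N. intros n Hn. specialize (HN n Hn).
    pose proof (pos_INR n). rewrite Rabs_pos_eq by (apply Rdiv_le_0_compat; lra).
    apply Rmult_le_reg_r with (2 * INR n + 1 - c); [lra|]. field_simplify; lra.
  - apply (log_growth_of_eventually_bounded _ (Rabs (1 + c))). exists N. intros n Hn.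
    specialize (HN n Hn). pose proof (pos_INR n). rewrite S_INR.
    set (x := 2 * INR n + 1 - c) in *.
    replace (2 * (INR n + 1) + 1 - c) with (x + 2) by (unfold x; ring).
    replace ((INR n + 1) * ((INR n + 1 + 1) * / (x + 2) - (INR n + 1) * / x))
      with (- (1 + c) * ((INR n + 1) / (x * (x + 2)))) by (unfold x in *; field; lra).
    rewrite Rabs_mult, Rabs_Ropp. rewrite <- (Rmult_1_r (Rabs (1 + c))) at 2.
    apply Rmult_le_compat_l; [apply Rabs_pos|].
    rewrite Rabs_pos_eq by (apply Rdiv_le_0_compat; nra).
    apply Rmult_le_reg_r with (x * (x + 2)); [nra|]. field_simplify; [nra|lra].
Qed.

Lemma log_regular_mult_inv_shift_pow f c k : log_regular f ->
  log_regular (fun n => (INR n + 1) * (f n * / (2 * INR n + 1 - c) ^ S k)).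
Proof.
  intros Hf. set (x := fun n => 2 * INR n + 1 - c).
  apply (log_regular_ext (fun n => f n * ((INR n + 1) * / x n) * (/ x n) ^ k)).
  - intros n. rewrite <- tech_pow_Rmult, Rinv_mult, pow_inv. unfold x. ring.
  - apply log_regular_mult.
    + apply log_regular_mult; [easy|apply log_regular_ratio_shift].
    + apply log_regular_pow, log_regular_inv_shift.
Qed.

(** * Logarithmic moments *)

Definition continuous_gtm1 (f : R -> R) : Prop := forall u, -1 < u -> continuous f u.

Lemma continuous_gtm1_const c : continuous_gtm1 (fun _ => c).
Proof. intros u _. apply continuous_const. Qed.

Lemma continuous_gtm1_id : continuous_gtm1 (fun u => u).
Proof. intros u _. apply continuous_id. Qed.

Lemma continuous_gtm1_plus f g : continuous_gtm1 f -> continuous_gtm1 g ->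
  continuous_gtm1 (fun u => f u + g u).
Proof. intros Hf Hg u Hu. apply (continuous_plus (V := R_NormedModule)); auto. Qed.

Lemma continuous_gtm1_minus f g : continuous_gtm1 f -> continuous_gtm1 g ->
  continuous_gtm1 (fun u => f u - g u).
Proof. intros Hf Hg u Hu. apply (continuous_minus (V := R_NormedModule)); auto. Qed.

Lemma continuous_gtm1_mult f g : continuous_gtm1 f -> continuous_gtm1 g ->
  continuous_gtm1 (fun u => f u * g u).
Proof. intros Hf Hg u Hu. apply (continuous_mult (K := R_AbsRing)); auto. Qed.

Lemma continuous_gtm1_pow f k : continuous_gtm1 f -> continuous_gtm1 (fun u => f u ^ k).
Proof.
  intros Hf. induction k; simpl; [apply continuous_gtm1_const|now apply continuous_gtm1_mult].
Qed.

Lemma continuous_gtm1_div f g : continuous_gtm1 f -> continuous_gtm1 g ->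
  (forall u, -1 < u -> g u <> 0) -> continuous_gtm1 (fun u => f u / g u).
Proof.
  intros Hf Hg Hg0. apply continuous_gtm1_mult; [easy|]. intros u Hu.
  apply (continuous_comp g Rinv); auto.
  apply (ex_derive_continuous (fun x => / x)). auto_derive. now apply Hg0.
Qed.

Lemma continuous_gtm1_lsum {A : Type} (f : A -> R -> R) l :
  (forall x, In x l -> continuous_gtm1 (f x)) ->
  continuous_gtm1 (fun u => lsum (map (fun x => f x u) l)).
Proof.
  induction l; simpl; intros H; [apply continuous_gtm1_const|].
  apply continuous_gtm1_plus; auto.
Qed.

Create HintDb continuous_gtm1.
#[local] Hint Resolve continuous_gtm1_const continuous_gtm1_id continuous_gtm1_plus
  continuous_gtm1_minus continuous_gtm1_mult continuous_gtm1_pow continuous_gtm1_lsum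
  : continuous_gtm1.

Lemma continuous_gtm1_ex_RInt f a b : continuous_gtm1 f -> -1 < a -> -1 < b -> ex_RInt f a b.
Proof.
  intros H Ha Hb. apply (@ex_RInt_continuous R_CompleteNormedModule). intros z [Hz _].
  apply H. eapply Rlt_le_trans; [|exact Hz]. now apply Rmin_glb_lt.
Qed.

Lemma locally_gtm1 u : -1 < u -> locally u (fun x => -1 < x).
Proof. intros Hu. now apply (open_gt (-1)). Qed.

Lemma is_derive_primitive f u : continuous_gtm1 f -> -1 < u ->
  is_derive (fun x => RInt f 0 x) u (f u).
Proof.
  intros H Hu. apply (is_derive_RInt f _ 0); [|now apply H].
  apply (filter_imp (fun x => -1 < x)); [|now apply locally_gtm1]. intros x Hx.
  apply (@RInt_correct R_CompleteNormedModule), continuous_gtm1_ex_RInt; auto; lra.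
Qed.

Definition avg (f : R -> R) (u : R) : R :=
  if Req_dec_T u 0 then f 0 else RInt f 0 u / u.

Lemma avg_0 f : avg f 0 = f 0.
Proof. unfold avg. destruct (Req_dec_T 0 0); lra. Qed.

Lemma avg_neq_0 f u : u <> 0 -> avg f u = RInt f 0 u / u.
Proof. unfold avg. destruct (Req_dec_T u 0); [contradiction|easy]. Qed.

Lemma continuous_avg_0 f : continuous_gtm1 f -> continuous (avg f) 0.
Proof.
  intros H. assert (Hd : is_derive (fun x => RInt f 0 x) 0 (f 0)).
  { apply is_derive_primitive; [easy|lra]. }
  apply is_derive_Reals in Hd. apply continuity_pt_filterlim. intros eps Heps.
  destruct (Hd eps Heps) as [d Hquot]. exists d. split; [apply cond_pos|].
  intros x [[_ Hx0] Hx]. simpl in Hx |- *. unfold R_dist in *. rewrite Rminus_0_r in Hx.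
  rewrite avg_0, avg_neq_0 by auto. specialize (Hquot x (not_eq_sym Hx0) Hx).
  rewrite Rplus_0_l, (RInt_point (V := R_CompleteNormedModule)) in Hquot.
  unfold zero in Hquot; simpl in Hquot. now rewrite Rminus_0_r in Hquot.
Qed.

Lemma continuous_gtm1_avg f : continuous_gtm1 f -> continuous_gtm1 (avg f).
Proof.
  intros H u Hu. destruct (Req_dec_T u 0) as [->|Hu0]; [now apply continuous_avg_0|].
  apply (continuous_ext_loc _ (fun x => RInt f 0 x / x)).
  - apply (filter_imp (fun x => x <> 0)); [|now apply open_neq].
    intros x Hx. symmetry. now apply avg_neq_0.
  - apply (continuous_mult (K := R_AbsRing)).
    + apply (ex_derive_continuous (fun x => RInt f 0 x)). exists (f u).
      now apply is_derive_primitive.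
    + apply (ex_derive_continuous (fun x => / x)). auto_derive. easy.
Qed.

#[local] Hint Resolve continuous_gtm1_avg : continuous_gtm1.

Lemma avg_le f g : continuous_gtm1 f -> continuous_gtm1 g ->
  (forall u, 0 <= u <= 1 -> f u <= g u) -> forall u, 0 <= u <= 1 -> avg f u <= avg g u.
Proof.
  intros Hf Hg H u Hu. destruct (Req_dec_T u 0) as [->|Hu0]; [rewrite !avg_0; now apply H|].
  rewrite !avg_neq_0 by easy. apply Rmult_le_compat_r.
  - left. apply Rinv_0_lt_compat. lra.
  - apply RInt_le; [lra|apply continuous_gtm1_ex_RInt; auto; lra..|].
    intros x Hx. apply H. lra.
Qed.

Lemma avg_linear f g c u : continuous_gtm1 f -> continuous_gtm1 g -> -1 < u ->
  avg (fun x => f x + c * g x) u = avg f u + c * avg g u.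
Proof.
  intros Hf Hg Hu. destruct (Req_dec_T u 0) as [->|Hu0]; [now rewrite !avg_0|].
  rewrite !avg_neq_0 by easy.
  assert (Ef : ex_RInt f 0 u) by (apply continuous_gtm1_ex_RInt; auto; lra).
  assert (Eg : ex_RInt g 0 u) by (apply continuous_gtm1_ex_RInt; auto; lra).
  assert (E : RInt (fun x => f x + c * g x) 0 u = RInt f 0 u + c * RInt g 0 u).
  { etransitivity.
    - apply (RInt_plus (V := R_CompleteNormedModule)); [exact Ef|].
      apply (ex_RInt_scal (V := R_NormedModule)). exact Eg.
    - apply (f_equal (Rplus (RInt f 0 u))).
      apply (RInt_scal (V := R_CompleteNormedModule)). exact Eg. }
  rewrite E. field. easy.
Qed.

(* [log_moment (S s) f] is the integral over [0, 1] of [(- ln u)^s / s! * f u]; iterated averaging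
   expresses it without improper integrals. *)
Fixpoint log_moment (s : nat) (f : R -> R) : R :=
  match s with
  | O => f 1
  | S s' => log_moment s' (avg f)
  end.

Lemma log_moment_le s f g : continuous_gtm1 f -> continuous_gtm1 g ->
  (forall u, 0 <= u <= 1 -> f u <= g u) -> log_moment s f <= log_moment s g.
Proof.
  revert f g. induction s as [|s IH]; intros f g Hf Hg H; simpl; [apply H; lra|].
  apply IH; auto with continuous_gtm1. now apply avg_le.
Qed.

Lemma log_moment_ext s f g : continuous_gtm1 f -> continuous_gtm1 g ->
  (forall u, 0 <= u <= 1 -> f u = g u) -> log_moment s f = log_moment s g.
Proof.
  intros Hf Hg H.
  apply Rle_antisym; apply log_moment_le; auto; intros u Hu; rewrite H by easy; lra.
Qed.

Lemma log_moment_linear s f g c : continuous_gtm1 f -> continuous_gtm1 g ->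
  log_moment s (fun u => f u + c * g u) = log_moment s f + c * log_moment s g.
Proof.
  revert f g. induction s as [|s IH]; intros f g Hf Hg; simpl; [reflexivity|].
  rewrite <- IH by auto with continuous_gtm1.
  apply log_moment_ext; auto with continuous_gtm1.
  intros u Hu. apply avg_linear; auto; lra.
Qed.

Lemma log_moment_0 s : log_moment s (fun _ => 0) = 0.
Proof.
  pose proof (log_moment_linear s (fun _ => 0) (fun _ => 0) 1) as H. cbv beta in H.
  rewrite (log_moment_ext s (fun _ => 0 + 1 * 0) (fun _ => 0)) in H by
    (auto with continuous_gtm1; intros; ring).
  specialize (H (continuous_gtm1_const 0) (continuous_gtm1_const 0)). lra.
Qed.

Lemma log_moment_scal s f c : continuous_gtm1 f ->
  log_moment s (fun u => c * f u) = c * log_moment s f.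
Proof.
  intros Hf. rewrite <- (Rplus_0_l (c * _)), <- (log_moment_0 s).
  rewrite <- log_moment_linear by auto with continuous_gtm1.
  apply log_moment_ext; auto with continuous_gtm1. intros; ring.
Qed.

Lemma log_moment_plus s f g : continuous_gtm1 f -> continuous_gtm1 g ->
  log_moment s (fun u => f u + g u) = log_moment s f + log_moment s g.
Proof.
  intros Hf Hg. rewrite <- (Rmult_1_l (log_moment s g)), <- log_moment_linear by easy.
  apply log_moment_ext; auto with continuous_gtm1. intros; ring.
Qed.

Lemma log_moment_lsum {A : Type} s (f : A -> R -> R) l :
  (forall x, In x l -> continuous_gtm1 (f x)) ->
  log_moment s (fun u => lsum (map (fun x => f x u) l)) =
  lsum (map (fun x => log_moment s (f x)) l).
Proof.
  induction l as [|x l IH]; simpl; intros H; [apply log_moment_0|].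
  rewrite log_moment_plus by auto with continuous_gtm1. rewrite IH; auto.
Qed.

Lemma log_moment_dist_le s f g h : continuous_gtm1 f -> continuous_gtm1 g -> continuous_gtm1 h ->
  (forall u, 0 <= u <= 1 -> Rabs (f u - g u) <= h u) ->
  Rabs (log_moment s f - log_moment s g) <= log_moment s h.
Proof.
  intros Hf Hg Hh H.
  replace (log_moment s f - log_moment s g) with (log_moment s (fun u => f u + -1 * g u))
    by (rewrite log_moment_linear by easy; ring).
  apply Rabs_le. rewrite <- (Rmult_1_l (log_moment s h)) at 1.
  rewrite <- Ropp_mult_distr_l_reverse, <- log_moment_scal by easy.
  split; apply log_moment_le; auto with continuous_gtm1; intros u Hu; specialize (H u Hu);
    apply Rabs_le_between in H; lra.
Qed.

Lemma Rabs_log_moment_le s f g : continuous_gtm1 f -> continuous_gtm1 g ->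
  (forall u, 0 <= u <= 1 -> Rabs (f u) <= g u) -> Rabs (log_moment s f) <= log_moment s g.
Proof.
  intros Hf Hg H. rewrite <- (Rminus_0_r (log_moment s f)), <- (log_moment_0 s).
  apply log_moment_dist_le; auto with continuous_gtm1.
  intros u Hu. rewrite Rminus_0_r. now apply H.
Qed.

(* Integration by parts: the weight [(- ln u)^s / s!] has derivative
   [- (1/u) (- ln u)^(s-1) / (s-1)!]. *)
Lemma log_moment_derive s f h : continuous_gtm1 f -> continuous_gtm1 h -> f 0 = h 0 ->
  (forall u, -1 < u -> is_derive (fun x => x * h x) u (f u)) ->
  log_moment (S s) f = log_moment s h.
Proof.
  intros Hf Hh Hfh0 Hd. simpl. apply log_moment_ext; auto with continuous_gtm1.
  intros u Hu. destruct (Req_dec_T u 0) as [->|Hu0]; [now rewrite avg_0|].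
  rewrite avg_neq_0 by easy.
  assert (E : is_RInt f 0 u (minus (u * h u) (0 * h 0))).
  { apply (is_RInt_derive (fun x => x * h x)); intros x Hx; [apply Hd|apply Hf];
      rewrite Rmin_left in Hx by lra; lra. }
  rewrite (is_RInt_unique _ _ _ _ E). unfold minus, plus, opp; simpl. field. easy.
Qed.

Lemma is_derive_monomial c k x : is_derive (fun x => c * x ^ S k) x (c * (INR (S k) * x ^ k)).
Proof.
  auto_derive; [easy|].
  change (match k with 0%nat => 1 | S _ => INR k + 1 end) with (INR (S k)). ring.
Qed.

Lemma log_moment_pow s k : log_moment s (fun u => u ^ k) = / INR (S k) ^ s.
Proof.
  assert (Hk : INR (S k) <> 0) by (apply not_0_INR; lia).
  induction s as [|s IH]; [simpl; rewrite pow1; field|].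
  rewrite (log_moment_derive s _ (fun u => / INR (S k) * u ^ k)); auto with continuous_gtm1.
  - rewrite log_moment_scal, IH by auto with continuous_gtm1.
    rewrite <- tech_pow_Rmult. now rewrite Rinv_mult.
  - destruct k; [simpl; field|]. rewrite pow_i by lia. ring.
  - intros u _. apply (is_derive_ext (fun x => / INR (S k) * x ^ S k)); [intros t; simpl; ring|].
    replace (u ^ k) with (/ INR (S k) * (INR (S k) * u ^ k)) by (field; easy).
    apply is_derive_monomial.
Qed.

Lemma log_moment_pow_le s k : log_moment (S s) (fun u => u ^ k) <= / (INR k + 1).
Proof.
  rewrite log_moment_pow, S_INR. pose proof (pos_INR k).
  apply Rinv_le_contravar; [lra|]. rewrite <- (pow_1 (INR k + 1)) at 1.
  apply Rle_pow; [lra|lia].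
Qed.

Lemma Rabs_div_ge1_le x y : 1 <= y -> Rabs (x / y) <= Rabs x.
Proof.
  intros Hy. unfold Rdiv.
  rewrite Rabs_mult, (Rabs_pos_eq (/ _)) by (left; apply Rinv_0_lt_compat; lra).
  rewrite <- (Rmult_1_r (Rabs x)) at 2. apply Rmult_le_compat_l; [apply Rabs_pos|].
  rewrite <- Rinv_1. apply Rinv_le_contravar; lra.
Qed.

Lemma continuous_gtm1_div_1p f : continuous_gtm1 f -> continuous_gtm1 (fun u => f u / (1 + u)).
Proof.
  intros Hf. apply continuous_gtm1_div; auto with continuous_gtm1. intros u Hu. lra.
Qed.

#[local] Hint Resolve continuous_gtm1_div_1p : continuous_gtm1.

Lemma is_series_zetabar s :
  is_series (fun n => (-1) ^ n / INR (S n) ^ S s) (log_moment (S s) (fun u => 1 / (1 + u))).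
Proof.
  set (b := fun n => log_moment (S s) (fun u => u ^ n / (1 + u))).
  apply (is_series_Rext (fun n => (-1) ^ n * (b n + b (S n)))).
  - intros n. unfold Rdiv. f_equal. rewrite <- log_moment_pow. unfold b.
    rewrite <- log_moment_plus by auto with continuous_gtm1.
    apply log_moment_ext; auto with continuous_gtm1. intros u Hu. simpl. field. lra.
  - apply (is_series_alternating_telescope b).
    apply (is_lim_seq_dist_le _ (fun n => 1 / (INR n + 1)));
      [|apply (log_growth_div_lim (fun _ => 1)), log_growth_const].
    intros n. rewrite Rminus_0_r. unfold Rdiv at 1. rewrite Rmult_1_l.
    eapply Rle_trans; [|apply (log_moment_pow_le s)].
    apply Rabs_log_moment_le; auto with continuous_gtm1.
    intros u Hu. eapply Rle_trans; [apply Rabs_div_ge1_le; lra|].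
    rewrite Rabs_pos_eq; [lra|apply pow_le; lra].
Qed.

(** * The Cayley transform *)

Definition cayley (u : R) : R := (1 - u) / (1 + u).

Lemma continuous_gtm1_cayley : continuous_gtm1 cayley.
Proof. apply continuous_gtm1_div_1p. auto with continuous_gtm1. Qed.

#[local] Hint Resolve continuous_gtm1_cayley : continuous_gtm1.

Lemma cayley_0 : cayley 0 = 1.
Proof. unfold cayley. field. Qed.

Lemma cayley_1 : cayley 1 = 0.
Proof. unfold cayley. field. Qed.

Lemma cayley_bounds u : 0 <= u <= 1 -> 0 <= cayley u <= 1.
Proof.
  intros Hu. unfold cayley. split; [apply Rdiv_le_0_compat; lra|].
  apply Rmult_le_reg_r with (1 + u); [lra|]. field_simplify; lra.
Qed.

Lemma is_derive_cayley u : -1 < u -> is_derive cayley u (- 2 / (1 + u) ^ 2).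
Proof. intros Hu. unfold cayley. auto_derive; [lra|]. field. lra. Qed.

Definition cayley_quotient (k : nat) (u : R) : R :=
  2 / (1 + u) * rsum (S k) (fun i => cayley u ^ i).

Definition cayley_density (k : nat) (u : R) : R := 2 / (1 + u) / (1 + u) * cayley u ^ k.

Lemma continuous_gtm1_cayley_quotient k : continuous_gtm1 (cayley_quotient k).
Proof. unfold cayley_quotient. auto 6 with continuous_gtm1. Qed.

Lemma continuous_gtm1_cayley_density k : continuous_gtm1 (cayley_density k).
Proof. unfold cayley_density. auto 6 with continuous_gtm1. Qed.

#[local] Hint Resolve continuous_gtm1_cayley_quotient continuous_gtm1_cayley_density
  : continuous_gtm1.

Lemma cayley_quotient_S k u :
  cayley_quotient (S k) u = cayley_quotient k u + 2 / (1 + u) * cayley u ^ S k.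
Proof. unfold cayley_quotient. rewrite (rsum_S (S k)). ring. Qed.

Lemma mul_cayley_quotient k u : -1 < u -> u * cayley_quotient k u = 1 - cayley u ^ S k.
Proof.
  intros Hu. induction k as [|k IH].
  - unfold cayley_quotient, cayley. rewrite rsum_S, rsum_0. simpl. field. lra.
  - rewrite cayley_quotient_S, Rmult_plus_distr_l, IH, <- (tech_pow_Rmult _ (S k)).
    generalize (cayley u ^ S k). intros x. unfold cayley. field. lra.
Qed.

Lemma cayley_quotient_SS k u : -1 < u ->
  cayley_quotient (S (S k)) u = cayley_quotient k u + 2 * cayley_density (S k) u.
Proof.
  intros Hu. rewrite !cayley_quotient_S, <- (tech_pow_Rmult _ (S k)). unfold cayley_density.
  generalize (cayley u ^ S k). intros x. unfold cayley. field. lra.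
Qed.

Lemma cayley_quotient_1 u : -1 < u -> cayley_quotient 1 u = 2 * cayley_density 0 u.
Proof.
  intros Hu. unfold cayley_quotient, cayley_density, cayley. rewrite !rsum_S, rsum_0.
  simpl. field. lra.
Qed.

Lemma is_derive_pow_cayley k u : -1 < u ->
  is_derive (fun x => 1 - cayley x ^ S k) u (INR (S k) * cayley_density k u).
Proof.
  intros Hu.
  replace (INR (S k) * cayley_density k u) with
    (- (- 2 / (1 + u) ^ 2 * (INR (S k) * cayley u ^ k))) by (unfold cayley_density; field; lra).
  auto_derive; [exists (- 2 / (1 + u) ^ 2); now apply is_derive_cayley|].
  replace (Derive _ u) with (- 2 / (1 + u) ^ 2)
    by (symmetry; apply is_derive_unique; now apply is_derive_cayley).
  change (match k with 0%nat => 1 | S _ => INR k + 1 end) with (INR (S k)). ring.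
Qed.

Lemma log_moment_cayley_density s k :
  log_moment (S s) (cayley_density k) = log_moment s (cayley_quotient k) / INR (S k).
Proof.
  assert (Hk : INR (S k) <> 0) by (apply not_0_INR; lia).
  enough (E : log_moment (S s) (fun u => INR (S k) * cayley_density k u) =
    log_moment s (cayley_quotient k)).
  { rewrite log_moment_scal in E by auto with continuous_gtm1. rewrite <- E. field. easy. }
  apply log_moment_derive; auto with continuous_gtm1.
  - unfold cayley_density, cayley_quotient. rewrite cayley_0, pow1.
    assert (E : forall n, rsum n (fun i => 1 ^ i) = INR n).
    { induction n as [|n IH]; [reflexivity|]. now rewrite rsum_S, IH, pow1, S_INR. }
    rewrite E. field.
  - intros u Hu. apply (is_derive_ext_loc (fun x => 1 - cayley x ^ S k)).
    + apply (filter_imp (fun x => -1 < x)); [|now apply locally_gtm1].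
      intros x Hx. symmetry. now apply mul_cayley_quotient.
    + now apply is_derive_pow_cayley.
Qed.

Lemma log_moment_O_cayley_quotient k : log_moment 0 (cayley_quotient k) = 1.
Proof.
  simpl. unfold cayley_quotient. rewrite cayley_1, rsum_S_l, rsum_eq_0; [simpl; field|].
  intros. apply pow_i. lia.
Qed.

Lemma log_moment_cayley_quotient_SS s k :
  log_moment (S s) (cayley_quotient (S (S k))) =
  log_moment (S s) (cayley_quotient k) + 2 / INR (S (S k)) * log_moment s (cayley_quotient (S k)).
Proof.
  transitivity (log_moment (S s) (cayley_quotient k) +
    2 * log_moment (S s) (cayley_density (S k))).
  - rewrite <- log_moment_linear by auto with continuous_gtm1.
    apply log_moment_ext; auto with continuous_gtm1.
    intros u Hu. apply cayley_quotient_SS. lra.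
  - rewrite log_moment_cayley_density. field. apply not_0_INR; lia.
Qed.

Lemma log_moment_cayley_quotient_1 s :
  log_moment (S s) (cayley_quotient 1) = 2 * log_moment s (cayley_quotient 0).
Proof.
  transitivity (2 * log_moment (S s) (cayley_density 0)).
  - rewrite <- log_moment_scal by auto with continuous_gtm1.
    apply log_moment_ext; auto with continuous_gtm1.
    intros u Hu. apply cayley_quotient_1. lra.
  - rewrite log_moment_cayley_density. simpl. field.
Qed.

Lemma log_moment_cayley_quotient_0 s : log_moment s (cayley_quotient 0) = 2 * zetabar s.
Proof.
  destruct s as [|s]; [rewrite log_moment_O_cayley_quotient; simpl; field|].
  unfold zetabar. rewrite (is_series_unique _ _ (is_series_zetabar s)).
  rewrite <- log_moment_scal by auto with continuous_gtm1.
  apply log_moment_ext; auto with continuous_gtm1.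
  intros u Hu. unfold cayley_quotient. rewrite rsum_S, rsum_0. simpl. field. lra.
Qed.

(** * Chains of alternating parity *)

(* The sum of [2^k / (m_1 ... m_k)] over [0 < m_1 < ... < m_k <= N] with [m_i = i (mod 2)],
   provided [N = k (mod 2)]; it vanishes for the other parity. Putting [m_(2i-1) = 2 n_(2i-1) - 1]
   and [m_(2i) = 2 n_(2i)], one recognizes [T_n({1}_{2a})] for [k = 2 a] and [N = 2 n - 2]. *)
Fixpoint parity_chain (N k : nat) {struct N} : R :=
  match N with
  | O => match k with O => 1 | S _ => 0 end
  | S N1 =>
      match N1 with O => 0 | S N2 => parity_chain N2 k end +
      match k with O => 0 | S k' => 2 / INR N * parity_chain N1 k' end
  end.

Lemma parity_chain_SS_O N : parity_chain (S (S N)) 0 = parity_chain N 0.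
Proof. apply Rplus_0_r. Qed.

Lemma parity_chain_1_S k : parity_chain 1 (S k) = 2 * parity_chain 0 k.
Proof. simpl. field. Qed.

Lemma parity_chain_SS_S N k : parity_chain (S (S N)) (S k) =
  parity_chain N (S k) + 2 / INR (S (S N)) * parity_chain (S N) k.
Proof. reflexivity. Qed.

Lemma parity_chain_lt N k : (N < k)%nat -> parity_chain N k = 0.
Proof.
  revert k. induction N as [N IH] using lt_wf_ind. intros [|k] H; [lia|].
  destruct N as [|[|N]].
  - reflexivity.
  - rewrite parity_chain_1_S, IH by lia. ring.
  - rewrite parity_chain_SS_S, !IH by lia. ring.
Qed.

Lemma parity_chain_odd N k : Nat.odd (N + k) = true -> parity_chain N k = 0.
Proof.
  revert k. induction N as [N IH] using lt_wf_ind. intros k H.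
  destruct N as [|[|N]], k as [|k]; try discriminate.
  - reflexivity.
  - simpl. ring.
  - rewrite parity_chain_1_S, IH; [ring|lia|]. now rewrite Nat.add_succ_r in H.
  - rewrite parity_chain_SS_O, IH; auto with arith.
  - rewrite parity_chain_SS_S, !IH; [ring|lia| |lia|easy].
    now rewrite <- Nat.add_succ_comm in H.
Qed.

Lemma parity_chain_add_double p n k : parity_chain (p + 2 * n) (S k) = parity_chain p (S k) +
  rsum n (fun i => 2 / INR (S (S (p + 2 * i))) * parity_chain (S (p + 2 * i)) k).
Proof.
  induction n as [|n IH].
  - rewrite Nat.mul_0_r, Nat.add_0_r, rsum_0. ring.
  - replace (p + 2 * S n)%nat with (S (S (p + 2 * n))) by lia.
    rewrite parity_chain_SS_S, IH, rsum_S. ring.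
Qed.

Lemma parity_chain_S_sum p n k : (p <= S k)%nat -> parity_chain (S (p + 2 * n)) (S k) =
  rsum (S n) (fun i => 2 / INR (S (p + 2 * i)) * parity_chain (p + 2 * i) k).
Proof.
  intros Hp. rewrite <- Nat.add_succ_l, parity_chain_add_double, rsum_S_l.
  rewrite Nat.mul_0_r, Nat.add_0_r. f_equal.
  - destruct p as [|p]; [rewrite parity_chain_1_S; simpl; field|].
    rewrite parity_chain_SS_S, (parity_chain_lt p) by lia. ring.
  - apply rsum_ext. intros i _. replace (p + 2 * S i)%nat with (S (S p + 2 * i)) by lia.
    reflexivity.
Qed.

Lemma parity_chain_double_O n : parity_chain (2 * n) 0 = 1.
Proof.
  induction n as [|n IH]; [reflexivity|].
  replace (2 * S n)%nat with (S (S (2 * n))) by lia. now rewrite parity_chain_SS_O.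
Qed.

Lemma Tsum_S_S a n : Tsum (S a) (S (S n)) = Tsum (S a) (S n) +
  / (INR n + 1) * rsum (S n) (fun i => 2 / (2 * INR i + 1) * Tsum a (S i)).
Proof.
  set (summand := fun i j =>
    Tsum a (S i) * 4 / ((2 * INR i + 1) * (2 * (INR i + 1 + INR j)))).
  assert (E : forall n, Tsum (S a) (S n) = rsum n (fun i => rsum (n - i) (summand i))).
  { clear n. intros n. cbn [Tsum]. rewrite fsum_rsum.
    replace (S (S n - 1) - 1)%nat with n by lia. apply rsum_ext. intros i Hi.
    rewrite fsum_rsum. replace (S (S n - 1) - (1 + i))%nat with (n - i)%nat by lia.
    apply rsum_ext. intros j Hj. unfold summand. change (1 + i)%nat with (S i).
    rewrite plus_INR, S_INR. f_equal. f_equal. ring. }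
  rewrite !E, (rsum_S n (fun i => rsum (S n - i) _)), Nat.sub_succ_l, Nat.sub_diag by lia.
  rewrite (rsum_ext n (fun i => rsum (S n - i) _) (fun i => rsum (n - i) (summand i) +
    / (INR n + 1) * (2 / (2 * INR i + 1) * Tsum a (S i)))).
  - rewrite lsum_plus, lsum_scal, !rsum_S, rsum_0. unfold summand. simpl (INR 0).
    pose proof (pos_INR n). field. lra.
  - intros i Hi. rewrite Nat.sub_succ_l, rsum_S by lia. f_equal. unfold summand.
    rewrite minus_INR by lia. pose proof (pos_INR n). pose proof (pos_INR i). field. lra.
Qed.

Lemma INR_double n : INR (2 * n) = 2 * INR n.
Proof. now rewrite mult_INR. Qed.

Lemma Tsum_parity_chain a n : Tsum a (S n) = parity_chain (2 * n) (2 * a).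
Proof.
  revert n. induction a as [|a IHa]; intros n; [now rewrite parity_chain_double_O|].
  replace (2 * S a)%nat with (S (S (2 * a))) by lia.
  induction n as [|n IHn]; [reflexivity|].
  rewrite Tsum_S_S, IHn. replace (2 * S n)%nat with (S (S (2 * n))) by lia.
  rewrite parity_chain_SS_S, (parity_chain_S_sum 0 n) by lia.
  rewrite !S_INR, INR_double. pose proof (pos_INR n). f_equal. f_equal; [field; lra|].
  apply rsum_ext. intros i _. now rewrite IHa, Nat.add_0_l, S_INR, INR_double.
Qed.

Lemma log_growth_weighted_partial_sums p f : log_growth f ->
  log_growth (fun N => rsum N (fun i => 2 / INR (S (p + 2 * i)) * f i)).
Proof.
  intros Hf. apply log_growth_partial_sums.
  apply (log_growth_ext (fun n => 2 * ((INR n + 1) * / (2 * INR n + 1 - - INR p)) * f n)).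
  - intros n. rewrite S_INR, plus_INR, INR_double. pose proof (pos_INR n). pose proof (pos_INR p).
    field. lra.
  - apply log_growth_mult; [|easy]. apply log_growth_mult; [apply log_growth_const|].
    apply log_regular_log_growth, log_regular_ratio_shift.
Qed.

Lemma log_growth_parity_chain p k : log_growth (fun n => parity_chain (p + 2 * n) k).
Proof.
  revert p. induction k as [|k IH]; intros p.
  - apply (log_growth_ext (fun _ => parity_chain p 0)); [|apply log_growth_const].
    induction n as [|n IHn]; [now rewrite Nat.mul_0_r, Nat.add_0_r|].
    replace (p + 2 * S n)%nat with (S (S (p + 2 * n))) by lia. now rewrite parity_chain_SS_O.
  - apply (log_growth_ext _ _ (fun n => eq_sym (parity_chain_add_double p n k))).
    apply log_growth_plus; [apply log_growth_const|].
    exact (log_growth_weighted_partial_sums (S p)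
      (fun i => parity_chain (S p + 2 * i) k) (IH (S p))).
Qed.

Definition double_zetabar (s : nat) : R := 2 * zetabar s.

Lemma double_zetabar_0 : double_zetabar 0 = 1.
Proof. unfold double_zetabar. simpl. field. Qed.

Lemma log_moment_cayley_quotient_conv N s : Nat.even (N + s) = true ->
  log_moment s (cayley_quotient N) = conv (parity_chain N) double_zetabar s.
Proof.
  revert s. induction N as [N IH] using lt_wf_ind. intros s Hpar.
  destruct N as [|[|N]].
  - rewrite log_moment_cayley_quotient_0. unfold conv. rewrite rsum_S_l, rsum_eq_0.
    + rewrite Nat.sub_0_r. unfold double_zetabar. simpl. ring.
    + intros i _. simpl. ring.
  - destruct s as [|s]; [discriminate|].
    rewrite log_moment_cayley_quotient_1, IH by (lia || easy). unfold conv.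
    rewrite (rsum_S_l (S s)), <- lsum_scal. simpl (parity_chain 1 0).
    rewrite Rplus_0_l, Rmult_0_l, Rplus_0_l. apply rsum_ext. intros i _.
    rewrite parity_chain_1_S. simpl (S s - S i)%nat. ring.
  - destruct s as [|s].
    + transitivity (log_moment 0 (cayley_quotient N)).
      * now rewrite !log_moment_O_cayley_quotient.
      * rewrite IH by (lia || easy). unfold conv. now rewrite !rsum_S, parity_chain_SS_O.
    + assert (Hpar' : Nat.even (S N + s) = true) by (rewrite Nat.add_succ_comm; exact Hpar).
      rewrite log_moment_cayley_quotient_SS, !IH by (lia || easy).
      unfold conv. rewrite !(rsum_S_l (S s)), parity_chain_SS_O, Rplus_assoc. f_equal.
      rewrite <- lsum_scal, <- lsum_plus. apply rsum_ext. intros i _.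
      rewrite parity_chain_SS_S. simpl (S s - S i)%nat. ring.
Qed.

Lemma conv_parity_chain_Tsum n q : conv (parity_chain (2 * n)) double_zetabar (2 * q) =
  conv (fun b => Tsum b (S n)) (fun d => double_zetabar (2 * d)) q.
Proof.
  unfold conv. rewrite rsum_even_support.
  - apply rsum_ext. intros b Hb. rewrite <- Nat.mul_sub_distr_l. f_equal. symmetry.
    apply Tsum_parity_chain.
  - intros i. rewrite parity_chain_odd; [ring|]. rewrite Nat.odd_spec. exists (n + i)%nat. lia.
Qed.

(** * Powers of the arctangent *)

Definition atan_pow (j : nat) (v : R) : R := (2 * atan v) ^ j / INR (fact j).

Lemma is_derive_atan_pow j v : is_derive (atan_pow (S j)) v (2 * (atan_pow j v / (1 + v ^ 2))).
Proof.
  unfold atan_pow. rewrite fact_simpl, mult_INR.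
  assert (INR (S j) <> 0) by (apply not_0_INR; lia). pose proof (INR_fact_neq_0 j) as Hf.
  revert Hf. generalize (INR (fact j)). intros y Hy. auto_derive; [easy|].
  change (match j with 0%nat => 1 | S _ => INR j + 1 end) with (INR (S j)). unfold Rsqr.
  field. repeat split; auto. nra.
Qed.

Lemma atan_pow_S_0 j : atan_pow (S j) 0 = 0.
Proof. unfold atan_pow. rewrite atan_0, Rmult_0_r, pow_i by lia. unfold Rdiv. ring. Qed.

Lemma is_derive_lsum {A : Type} (f : A -> R -> R) (df : A -> R) x l :
  (forall i, In i l -> is_derive (f i) x (df i)) ->
  is_derive (fun y => lsum (map (fun i => f i y) l)) x (lsum (map df l)).
Proof.
  induction l; simpl; intros H; [apply (is_derive_const (V := R_NormedModule))|].
  apply (is_derive_plus (V := R_NormedModule)); auto.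
Qed.

Lemma Rabs_le_of_derive_le F dF C k : F 0 = 0 -> (forall x, is_derive F x (dF x)) ->
  (forall x, 0 <= x <= 1 -> Rabs (dF x) <= C * x ^ k) ->
  forall x, 0 <= x <= 1 -> Rabs (F x) <= C * x ^ S k.
Proof.
  intros HF0 Hd Hb x Hx.
  assert (HC : 0 <= C).
  { specialize (Hb 1 ltac:(lra)). rewrite pow1, Rmult_1_r in Hb.
    pose proof (Rabs_pos (dF 1)). lra. }
  destruct (MVT_gen F 0 x dF) as [c [Hc E]].
  - intros; apply Hd.
  - intros y _. apply continuity_pt_filterlim, (ex_derive_continuous F). eexists; apply Hd.
  - rewrite Rmin_left, Rmax_right in Hc by lra.
    rewrite HF0, !Rminus_0_r in E. rewrite E, Rabs_mult, (Rabs_pos_eq x) by lra.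
    simpl. rewrite (Rmult_comm x (x ^ k)), <- Rmult_assoc. apply Rmult_le_compat_r; [lra|].
    eapply Rle_trans; [apply Hb; lra|]. apply Rmult_le_compat_l, pow_incr; lra.
Qed.

Lemma alternating_sum_by_parts d N x : (1 + x) * rsum N (fun i => (- x) ^ i * rsum (S i) d) =
  rsum N (fun i => (- x) ^ i * d i) - (- x) ^ N * rsum N d.
Proof.
  induction N as [|N IH]; [rewrite !rsum_0; ring|].
  rewrite !rsum_S, Rmult_plus_distr_l, IH. simpl. ring.
Qed.

Definition atan_coef (k i : nat) : R := parity_chain (k + 2 * i) k.

Lemma atan_coef_S k n :
  atan_coef (S k) n = rsum (S n) (fun i => 2 / INR (S (k + 2 * i)) * atan_coef k i).
Proof. apply parity_chain_S_sum. lia. Qed.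

Definition atan_partial_sum (k N : nat) (v : R) : R :=
  rsum N (fun i => (-1) ^ i * atan_coef k i * v ^ (k + 2 * i)).

Definition atan_primitive (k N : nat) (v : R) : R :=
  rsum N (fun i => (-1) ^ i * (2 / INR (S (k + 2 * i)) * atan_coef k i) * v ^ S (k + 2 * i)).

Lemma is_derive_atan_primitive k N v :
  is_derive (atan_primitive k N) v (2 * atan_partial_sum k N v).
Proof.
  unfold atan_partial_sum. rewrite <- lsum_scal.
  rewrite (rsum_ext N _ (fun i => (-1) ^ i * (2 / INR (S (k + 2 * i)) * atan_coef k i) *
    (INR (S (k + 2 * i)) * v ^ (k + 2 * i)))).
  - apply (is_derive_lsum (fun i x => _ * x ^ S (k + 2 * i))).
    intros i _. apply is_derive_monomial.
  - intros i _. field. apply not_0_INR. lia.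
Qed.

Lemma pow_neg_sq v i : (- v ^ 2) ^ i = (-1) ^ i * v ^ (2 * i).
Proof. rewrite pow_mult, <- Rpow_mult_distr. f_equal. ring. Qed.

Lemma atan_partial_sum_S k N v : (1 + v ^ 2) * atan_partial_sum (S k) N v =
  atan_primitive k N v -
  (-1) ^ N * rsum N (fun i => 2 / INR (S (k + 2 * i)) * atan_coef k i) * v ^ (S k + 2 * N).
Proof.
  set (d := fun i => 2 / INR (S (k + 2 * i)) * atan_coef k i).
  replace (atan_partial_sum (S k) N v) with
    (v ^ S k * rsum N (fun i => (- v ^ 2) ^ i * rsum (S i) d)).
  - replace (atan_primitive k N v) with (v ^ S k * rsum N (fun i => (- v ^ 2) ^ i * d i)).
    + transitivity (v ^ S k * ((1 + v ^ 2) * rsum N (fun i => (- v ^ 2) ^ i * rsum (S i) d)));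
        [ring|].
      rewrite alternating_sum_by_parts, pow_add, (pow_neg_sq v N). ring.
    + unfold atan_primitive. rewrite <- lsum_scal. apply rsum_ext. intros i _.
      change (v ^ S (k + 2 * i)) with (v ^ (S k + 2 * i)). rewrite pow_neg_sq, pow_add.
      unfold d. ring.
  - unfold atan_partial_sum. rewrite <- lsum_scal. apply rsum_ext. intros i _.
    rewrite pow_neg_sq, pow_add, atan_coef_S. fold d. ring.
Qed.

Lemma atan_pow_0_partial_sum N v : (1 + v ^ 2) * atan_partial_sum 0 N v =
  atan_pow 0 v - (-1) ^ N * v ^ (2 * N).
Proof.
  unfold atan_pow. simpl (fact 0). induction N as [|N IH].
  - unfold atan_partial_sum. rewrite rsum_0. simpl. field.
  - unfold atan_partial_sum in *. rewrite rsum_S, Rmult_plus_distr_l, IH.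
    unfold atan_coef. rewrite !Nat.add_0_l, parity_chain_double_O.
    replace (2 * S N)%nat with (S (S (2 * N))) by lia. simpl pow. ring.
Qed.

Lemma Rabs_atan_primitive_le k N C :
  (forall v, 0 <= v <= 1 ->
    Rabs (atan_partial_sum k N v - atan_pow k v / (1 + v ^ 2)) <= C * v ^ (k + 2 * N)) ->
  forall v, 0 <= v <= 1 ->
    Rabs (atan_primitive k N v - atan_pow (S k) v) <= 2 * C * v ^ (S k + 2 * N).
Proof.
  intros H. apply (Rabs_le_of_derive_le _
    (fun v => 2 * (atan_partial_sum k N v - atan_pow k v / (1 + v ^ 2)))).
  - rewrite atan_pow_S_0. unfold atan_primitive. rewrite rsum_eq_0; [ring|].
    intros i _. rewrite pow_i by lia. ring.
  - intros v. rewrite Rmult_minus_distr_l.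
    apply (is_derive_minus (V := R_NormedModule));
      [apply is_derive_atan_primitive|apply is_derive_atan_pow].
  - intros v Hv. rewrite Rabs_mult, (Rabs_pos_eq 2), Rmult_assoc by lra.
    apply Rmult_le_compat_l; [lra|]. now apply H.
Qed.

(* [atan_pow (S k)] is a primitive of [2 atan_pow k v / (1 + v^2)]; dividing it by [1 + v^2]
   replaces the coefficients by their partial sums. *)
Lemma atan_partial_sum_bound k : exists D, log_growth D /\ forall N v, 0 <= v <= 1 ->
  Rabs (atan_partial_sum k N v - atan_pow k v / (1 + v ^ 2)) <= D N * v ^ (k + 2 * N).
Proof.
  assert (Hpos : forall v, 1 <= 1 + v ^ 2) by (intros v; pose proof (pow2_ge_0 v); lra).
  induction k as [|k [D [HD HDb]]].
  - exists (fun _ => 1). split; [apply log_growth_const|]. intros N v Hv. specialize (Hpos v).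
    replace (_ - _) with (- ((-1) ^ N * v ^ (2 * N)) / (1 + v ^ 2)).
    + eapply Rle_trans; [now apply Rabs_div_ge1_le|].
      rewrite Rabs_Ropp, Rabs_mult, pow_1_abs, Rabs_pos_eq by (apply pow_le; lra).
      apply Rle_refl.
    + apply Rmult_eq_reg_l with (1 + v ^ 2); [|lra].
      rewrite Rmult_minus_distr_l, atan_pow_0_partial_sum. field. lra.
  - set (s := fun N => rsum N (fun i => 2 / INR (S (k + 2 * i)) * atan_coef k i)).
    exists (fun N => 2 * D N + Rabs (s N)). split.
    + apply log_growth_plus; [apply log_growth_mult; auto using log_growth_const|].
      apply log_growth_abs, log_growth_weighted_partial_sums, log_growth_parity_chain.
    + intros N v Hv. specialize (Hpos v).
      replace (_ - _) with ((atan_primitive k N v - atan_pow (S k) v +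
        - ((-1) ^ N * s N * v ^ (S k + 2 * N))) / (1 + v ^ 2)).
      * eapply Rle_trans; [now apply Rabs_div_ge1_le|].
        eapply Rle_trans; [apply Rabs_triang|]. rewrite Rmult_plus_distr_r.
        apply Rplus_le_compat; [apply Rabs_atan_primitive_le; auto|].
        rewrite Rabs_Ropp, !Rabs_mult, pow_1_abs, Rmult_1_l.
        rewrite (Rabs_pos_eq (v ^ _)) by (apply pow_le; lra). apply Rle_refl.
      * apply Rmult_eq_reg_l with (1 + v ^ 2); [|lra].
        rewrite Rmult_minus_distr_l, atan_partial_sum_S. fold (s N). field. lra.
Qed.

(* [2 atan ((1 - u) / (1 + u)) = PI / 2 - 2 atan u] *)
Definition atan_cayley (j : nat) (u : R) : R := atan_pow j (cayley u).

Lemma continuous_gtm1_atan_cayley j : continuous_gtm1 (atan_cayley j).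
Proof.
  intros u Hu. apply (continuous_comp cayley (atan_pow j)); [now apply continuous_gtm1_cayley|].
  apply (ex_derive_continuous (atan_pow j)). unfold atan_pow. auto_derive. easy.
Qed.

Lemma continuous_gtm1_div_1p_sq f : continuous_gtm1 f ->
  continuous_gtm1 (fun u => f u / (1 + u ^ 2)).
Proof.
  intros Hf. apply continuous_gtm1_div; auto with continuous_gtm1.
  intros u _. pose proof (pow2_ge_0 u). lra.
Qed.

#[local] Hint Resolve continuous_gtm1_atan_cayley continuous_gtm1_div_1p_sq : continuous_gtm1.

Lemma one_plus_cayley_sqr u : -1 < u -> 1 + cayley u ^ 2 = 2 * (1 + u ^ 2) / (1 + u) ^ 2.
Proof. intros Hu. unfold cayley. field. lra. Qed.

Lemma atan_cayley_div j u : -1 < u -> atan_cayley j u / (1 + u ^ 2) =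
  2 / (1 + u) / (1 + u) * (atan_pow j (cayley u) / (1 + cayley u ^ 2)).
Proof.
  intros Hu. unfold atan_cayley. generalize (atan_pow j (cayley u)). intros x.
  rewrite one_plus_cayley_sqr by easy. pose proof (pow2_ge_0 u). field. simpl in *. split; lra.
Qed.

Lemma is_derive_atan_cayley j u : -1 < u ->
  is_derive (atan_cayley (S j)) u (-2 * (atan_cayley j u / (1 + u ^ 2))).
Proof.
  intros Hu.
  pose proof (is_derive_comp (atan_pow (S j)) cayley u _ _
    (is_derive_atan_pow j (cayley u)) (is_derive_cayley u Hu)) as H.
  replace (-2 * (atan_cayley j u / (1 + u ^ 2))) with
    (scal (- 2 / (1 + u) ^ 2) (2 * (atan_pow j (cayley u) / (1 + cayley u ^ 2)))); [exact H|].
  rewrite atan_cayley_div by easy. unfold scal; simpl. unfold mult; simpl.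
  generalize (atan_pow j (cayley u) / (1 + cayley u * (cayley u * 1))). intros x. field. lra.
Qed.

Lemma Rabs_atan_cayley_le j u : 0 <= u <= 1 -> Rabs (atan_cayley j u) <= 2 ^ j.
Proof.
  intros Hu. destruct (cayley_bounds u Hu) as [Hge0 Hle1]. unfold atan_cayley, atan_pow.
  assert (Ha : 0 <= atan (cayley u) <= PI / 4).
  { rewrite <- atan_0, <- atan_1. split.
    - destruct Hge0 as [Hlt|Heq]; [left; now apply atan_increasing|right; now rewrite <- Heq].
    - destruct Hle1 as [Hlt|Heq]; [left; now apply atan_increasing|right; now rewrite Heq]. }
  pose proof PI_4. eapply Rle_trans; [apply Rabs_div_ge1_le, (le_INR 1), lt_O_fact|].
  rewrite <- RPow_abs. apply pow_incr. split; [apply Rabs_pos|]. rewrite Rabs_pos_eq; lra.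
Qed.

Lemma Rabs_cayley_density_sum_le k N C u : 0 <= u <= 1 ->
  Rabs (atan_partial_sum k N (cayley u) - atan_pow k (cayley u) / (1 + cayley u ^ 2))
    <= C * cayley u ^ (k + 2 * N) ->
  Rabs (rsum N (fun i => (-1) ^ i * atan_coef k i * cayley_density (k + 2 * i) u) -
    atan_cayley k u / (1 + u ^ 2)) <= C * cayley_density (k + 2 * N) u.
Proof.
  intros Hu H. set (w := 2 / (1 + u) / (1 + u)).
  assert (Hw : 0 <= w) by (unfold w; repeat apply Rdiv_le_0_compat; lra).
  replace (rsum N _) with (w * atan_partial_sum k N (cayley u)).
  - rewrite atan_cayley_div by lra. fold w.
    rewrite <- Rmult_minus_distr_l, Rabs_mult, Rabs_pos_eq by easy.
    unfold cayley_density. fold w. replace (C * (w * _)) with (w * (C * cayley u ^ (k + 2 * N)))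
      by ring. now apply Rmult_le_compat_l.
  - unfold atan_partial_sum. rewrite <- lsum_scal. apply rsum_ext. intros i _.
    unfold cayley_density. fold w. ring.
Qed.

Definition atan_cauchy_moment (k j s : nat) : R :=
  log_moment (S s) (fun u => u ^ k * atan_cayley j u / (1 + u ^ 2)).

Lemma is_series_atan_coef k s : Nat.even (k + s) = true ->
  is_series (fun i => (-1) ^ i * atan_coef k i *
      (conv (parity_chain (k + 2 * i)) double_zetabar s / INR (S (k + 2 * i))))
    (atan_cauchy_moment 0 k s).
Proof.
  intros Hpar. destruct (atan_partial_sum_bound k) as [D [HD H]].
  set (M := fun N => conv (parity_chain (k + 2 * N)) double_zetabar s).
  assert (HM : forall N, log_moment (S s) (cayley_density (k + 2 * N)) = M N / INR (S (k + 2 * N))).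
  { intros N. rewrite log_moment_cayley_density, log_moment_cayley_quotient_conv; [easy|].
    replace (k + 2 * N + s)%nat with (k + s + 2 * N)%nat by lia.
    now rewrite Nat.even_add_mul_2. }
  set (h := fun i u => (-1) ^ i * atan_coef k i * cayley_density (k + 2 * i) u).
  assert (Hh : forall i, continuous_gtm1 (h i)) by (unfold h; auto with continuous_gtm1).
  apply is_series_rsum, (is_lim_seq_dist_le _ (fun N => Rabs (D N * M N / (INR N + 1)))).
  - intros N. rewrite (rsum_ext N _ (fun i => log_moment (S s) (h i))).
    2:{ intros i _. unfold h. now rewrite log_moment_scal, HM by auto with continuous_gtm1. }
    rewrite <- log_moment_lsum by auto.
    eapply Rle_trans;
      [apply (log_moment_dist_le _ _ _ (fun u => D N * cayley_density (k + 2 * N) u))|];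
      auto with continuous_gtm1.
    + intros u Hu. rewrite pow_O, Rmult_1_l.
      apply Rabs_cayley_density_sum_le; [easy|]. now apply H, cayley_bounds.
    + rewrite log_moment_scal, HM by auto with continuous_gtm1.
      eapply Rle_trans; [apply Rle_abs|]. unfold Rdiv. rewrite <- Rmult_assoc.
      rewrite !(Rabs_mult (_ * _)). apply Rmult_le_compat_l; [apply Rabs_pos|].
      pose proof (pos_INR N). pose proof (pos_INR k). rewrite S_INR, plus_INR, INR_double.
      rewrite !Rabs_pos_eq by (left; apply Rinv_0_lt_compat; lra).
      apply Rinv_le_contravar; lra.
  - apply (proj1 (is_lim_seq_abs_0 _)), (log_growth_div_lim (fun N => D N * M N)).
    apply log_growth_mult; [easy|].
    apply (log_growth_lsum (fun t N => parity_chain (k + 2 * N) t * double_zetabar (s - t))).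
    intros t _. apply log_growth_mult; [apply log_growth_parity_chain|apply log_growth_const].
Qed.

Lemma is_series_Tsum_moment a q :
  is_series (fun n => (-1) ^ n * Tsum a (S n) *
      (conv (fun b => Tsum b (S n)) (fun d => double_zetabar (2 * d)) q / (2 * INR n + 1)))
    ((-1) ^ a * atan_cauchy_moment 0 (2 * a) (2 * q)).
Proof.
  apply (is_series_leading_zeros a).
  - intros n Hn. rewrite Tsum_parity_chain, parity_chain_lt by lia. ring.
  - apply (is_series_Rext (fun i => (-1) ^ a * ((-1) ^ i * atan_coef (2 * a) i *
      (conv (parity_chain (2 * a + 2 * i)) double_zetabar (2 * q) / INR (S (2 * a + 2 * i)))))).
    + intros i. rewrite Tsum_parity_chain, <- conv_parity_chain_Tsum, pow_add, <- INR_double.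
      rewrite Nat.mul_add_distr_l, S_INR. unfold atan_coef, Rdiv. ring.
    + apply is_series_Rscal, is_series_atan_coef.
      rewrite <- Nat.mul_add_distr_l. apply Nat.even_mul.
Qed.

(** * Shifted chains *)

(* The coefficient of [y^t] in the expansion of [2 / (x - y)]. *)
Definition geo_coef (x : R) (t : nat) : R := 2 / x ^ S t.

Definition atan_moment (k j s : nat) : R := log_moment (S s) (fun u => u ^ k * atan_cayley j u).

Lemma atan_cauchy_moment_add_SS k j s :
  atan_cauchy_moment k j s + atan_cauchy_moment (S (S k)) j s = atan_moment k j s.
Proof.
  unfold atan_cauchy_moment, atan_moment. rewrite <- log_moment_plus by auto with continuous_gtm1.
  apply log_moment_ext; auto with continuous_gtm1.
  intros u _. simpl. pose proof (pow2_ge_0 u). field. simpl in *. lra.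
Qed.

Lemma atan_moment_0 k s : atan_moment k 0 s = / 2 * geo_coef (INR (S k)) s.
Proof.
  unfold atan_moment, geo_coef. rewrite (log_moment_ext _ _ (fun u => u ^ k));
    auto with continuous_gtm1.
  - rewrite log_moment_pow. field. apply pow_nonzero, not_0_INR. lia.
  - intros u _. unfold atan_cayley, atan_pow. simpl. field.
Qed.

Lemma log_moment_pow_atan_cayley s k j :
  INR (S k) * log_moment (S s) (fun u => u ^ k * atan_cayley (S j) u) =
  log_moment s (fun u => u ^ k * atan_cayley (S j) u) + 2 * atan_cauchy_moment (S k) j s.
Proof.
  unfold atan_cauchy_moment.
  rewrite <- (log_moment_derive s (fun u => INR (S k) * (u ^ k * atan_cayley (S j) u) +
    -2 * (u ^ S k * atan_cayley j u / (1 + u ^ 2)))); auto 6 with continuous_gtm1.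
  - rewrite log_moment_linear, log_moment_scal by auto with continuous_gtm1. ring.
  - unfold Rdiv. rewrite (pow_i (S k)) by lia. destruct k; [simpl; ring|].
    rewrite pow_i by lia. ring.
  - intros u Hu. apply (is_derive_ext (fun x => 1 * x ^ S k * atan_cayley (S j) x));
      [intros x; simpl; ring|].
    replace (_ + _) with (1 * (INR (S k) * u ^ k) * atan_cayley (S j) u +
      1 * u ^ S k * (-2 * (atan_cayley j u / (1 + u ^ 2)))).
    + apply (is_derive_mult (K := R_AbsRing) (fun x => 1 * x ^ S k) (atan_cayley (S j)));
        [apply is_derive_monomial| |apply Rmult_comm].
      now apply is_derive_atan_cayley.
    + unfold Rdiv. ring.
Qed.

Lemma atan_moment_S k j s :
  atan_moment k (S j) s = conv (geo_coef (INR (S k))) (atan_cauchy_moment (S k) j) s.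
Proof.
  assert (Hk : INR (S k) <> 0) by (apply not_0_INR; lia). unfold atan_moment.
  induction s as [|s IH]; apply (Rmult_eq_reg_l (INR (S k))); auto;
    rewrite log_moment_pow_atan_cayley; unfold conv.
  - rewrite rsum_S, rsum_0. unfold geo_coef. cbn [Nat.sub log_moment]. unfold atan_cayley at 1.
    rewrite cayley_1, atan_pow_S_0. field. easy.
  - rewrite IH, (rsum_S_l (S s)), Rmult_plus_distr_l, <- lsum_scal, Rplus_comm. f_equal.
    + unfold geo_coef. rewrite Nat.sub_0_r, pow_1. field. easy.
    + apply rsum_ext. intros t _. simpl (S s - S t)%nat. unfold geo_coef.
      rewrite <- (tech_pow_Rmult _ (S t)). field. split; [apply pow_nonzero|]; easy.
Qed.

Lemma Rabs_atan_cauchy_moment_le k j s : Rabs (atan_cauchy_moment k j s) <= 2 ^ j * / (INR k + 1).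
Proof.
  apply Rle_trans with (log_moment (S s) (fun u => 2 ^ j * u ^ k)).
  - apply Rabs_log_moment_le; auto with continuous_gtm1.
    intros u Hu. pose proof (pow2_ge_0 u).
    eapply Rle_trans; [apply Rabs_div_ge1_le; lra|].
    rewrite Rabs_mult, (Rabs_pos_eq (u ^ k)), Rmult_comm by (apply pow_le; lra).
    apply Rmult_le_compat_r; [apply pow_le; lra|]. now apply Rabs_atan_cayley_le.
  - rewrite log_moment_scal by auto with continuous_gtm1.
    apply Rmult_le_compat_l, log_moment_pow_le. apply pow_le. lra.
Qed.

(* The coefficient of [y^t] in the sum of [2^r / ((2 n_1 - 1 - y) ... (2 n_r - r - y))] over
   [0 < n_1 < ... < n_r <= n]. *)
Fixpoint shifted_chain (r n t : nat) {struct r} : R :=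
  match r with
  | O => match t with O => 1 | S _ => 0 end
  | S r' => rsum n (fun i => conv (shifted_chain r' i) (geo_coef (2 * INR i + 1 - INR r')) t)
  end.

Lemma shifted_chain_lt r n t : (n < r)%nat -> shifted_chain r n t = 0.
Proof.
  revert n t. induction r as [|r IH]; intros n t H; [lia|]. simpl. apply rsum_eq_0.
  intros i Hi. apply conv_0_l. intros t'. apply IH. lia.
Qed.

Lemma shifted_chain_S_S r n t : shifted_chain (S r) (S n) t =
  shifted_chain (S r) n t + conv (shifted_chain r n) (geo_coef (2 * INR n + 1 - INR r)) t.
Proof. cbn [shifted_chain]. now rewrite rsum_S. Qed.

Lemma conv_shifted_chain_0_l n b s : conv (shifted_chain 0 n) b s = b s.
Proof.
  unfold conv. rewrite rsum_S_l, rsum_eq_0.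
  - simpl. rewrite Nat.sub_0_r. ring.
  - intros i _. simpl. ring.
Qed.

(* The subtractions in the lower indices of the moments convolved with [shifted_chain r n] are
   only truncated when [n < r], where the chain vanishes. *)
Lemma conv_shifted_chain_ext r n b b' s : ((r <= n)%nat -> forall t, b t = b' t) ->
  conv (shifted_chain r n) b s = conv (shifted_chain r n) b' s.
Proof.
  intros H. destruct (Nat.lt_ge_cases n r) as [Hn|Hn].
  - rewrite !conv_0_l; auto using shifted_chain_lt.
  - apply conv_ext; auto.
Qed.

Lemma log_growth_geo_coef c t : log_growth (fun n => (INR n + 1) * geo_coef (2 * INR n + 1 - c) t).
Proof.
  apply log_regular_log_growth.
  apply (log_regular_mult_inv_shift_pow (fun _ => 2)), log_regular_const.
Qed.

Lemma log_growth_shifted_chain r t : log_growth (fun n => shifted_chain r n t).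
Proof.
  revert t. induction r as [|r IH]; intros t; [destruct t; simpl; apply log_growth_const|].
  cbn [shifted_chain]. apply log_growth_partial_sums.
  set (f := fun j n => shifted_chain r n j *
    ((INR n + 1) * geo_coef (2 * INR n + 1 - INR r) (t - j))).
  apply (log_growth_ext (fun n => rsum (S t) (fun j => f j n))).
  - intros n. unfold conv. rewrite <- lsum_scal. apply rsum_ext. intros. unfold f. ring.
  - apply (log_growth_lsum f). intros j _.
    apply log_growth_mult; [apply IH|apply log_growth_geo_coef].
Qed.

Lemma log_growth_atan_cauchy_moment i j s :
  log_growth (fun n => (INR n + 1) * atan_cauchy_moment (2 * n - i) j s).
Proof.
  apply (log_growth_of_eventually_bounded _ (2 ^ j)). exists i. intros n Hn.
  pose proof (pos_INR n). rewrite Rabs_mult, Rabs_pos_eq by lra.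
  pose proof (Rabs_atan_cauchy_moment_le (2 * n - i) j s) as Hmoment.
  assert (Hle : / (INR (2 * n - i) + 1) <= / (INR n + 1)).
  { apply Rinv_le_contravar; [lra|]. apply Rplus_le_compat_r, le_INR. lia. }
  apply Rle_trans with ((INR n + 1) * (2 ^ j * / (INR n + 1))); [|right; field; lra].
  apply Rmult_le_compat_l; [lra|]. eapply Rle_trans; [exact Hmoment|].
  apply Rmult_le_compat_l; [apply pow_le; lra|easy].
Qed.

Lemma alternating_sum_telescope (a b : nat -> R) d : a 0%nat = b 0%nat ->
  (forall i, (i < d)%nat -> a (S i) = b (S i) + b i) ->
  rsum (S d) (fun i => (-1) ^ i * a i) = (-1) ^ d * b d.
Proof.
  intros Hstart Hstep. induction d as [|d IH]; rewrite rsum_S.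
  - rewrite rsum_0, Hstart. ring.
  - rewrite IH, Hstep by auto with arith. simpl. ring.
Qed.

(* Expanding [1 / (1 + u^2)] up to [u^(2n)] and integrating by parts [i] times produces the chains
   [n_1 < ... < n_i <= n]; up to sign, this is the sum of the integrals that are left over. *)
Definition cauchy_remainder (d s n : nat) : R :=
  rsum (S d) (fun i =>
    (-1) ^ i * conv (shifted_chain i n) (atan_cauchy_moment (2 * n - i) (d - i)) s).

Lemma cauchy_remainder_0 d s : cauchy_remainder d s 0 = atan_cauchy_moment 0 d s.
Proof.
  unfold cauchy_remainder. rewrite rsum_S_l, rsum_eq_0.
  - rewrite conv_shifted_chain_0_l, !Nat.sub_0_r. simpl. ring.
  - intros i _. rewrite conv_0_l; [ring|]. intros t. apply shifted_chain_lt. lia.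
Qed.

Lemma conv_chain_atan_cauchy_moment_add i n j s :
  conv (shifted_chain i n) (atan_cauchy_moment (2 * n - i) j) s +
    conv (shifted_chain i n) (atan_cauchy_moment (2 * S n - i) j) s =
  conv (shifted_chain i n) (atan_moment (2 * n - i) j) s.
Proof.
  rewrite <- conv_plus_r. apply conv_shifted_chain_ext. intros Hi t.
  replace (2 * S n - i)%nat with (S (S (2 * n - i))) by lia. apply atan_cauchy_moment_add_SS.
Qed.

Lemma INR_double_sub i n : (i <= n)%nat -> INR (S (2 * n - i)) = 2 * INR n + 1 - INR i.
Proof. intros H. rewrite S_INR, minus_INR, INR_double by lia. ring. Qed.

Lemma conv_chain_atan_moment_S i n j s :
  conv (shifted_chain i n) (atan_moment (2 * n - i) (S j)) s =
  conv (conv (shifted_chain i n) (geo_coef (2 * INR n + 1 - INR i)))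
    (atan_cauchy_moment (2 * S n - S i) j) s.
Proof.
  rewrite conv_assoc. apply conv_shifted_chain_ext. intros Hi t.
  rewrite atan_moment_S, INR_double_sub by easy.
  now replace (2 * S n - S i)%nat with (S (2 * n - i)) by lia.
Qed.

Lemma cauchy_remainder_add_S d s n : cauchy_remainder d s n + cauchy_remainder d s (S n) =
  (-1) ^ d * (/ 2 * conv (shifted_chain d n) (geo_coef (2 * INR n + 1 - INR d)) s).
Proof.
  set (Q := fun i m => conv (shifted_chain i m) (atan_cauchy_moment (2 * m - i) (d - i)) s).
  set (P := fun i => conv (shifted_chain i n) (atan_moment (2 * n - i) (d - i)) s).
  transitivity (rsum (S d) (fun i => (-1) ^ i * (Q i n + Q i (S n)))).
  { unfold cauchy_remainder. rewrite <- lsum_plus. apply rsum_ext. intros i _. unfold Q. ring. }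
  rewrite (alternating_sum_telescope _ P).
  - f_equal. unfold P. rewrite Nat.sub_diag, <- conv_scal_r.
    apply conv_shifted_chain_ext. intros Hd t. now rewrite atan_moment_0, INR_double_sub.
  - apply (conv_chain_atan_cauchy_moment_add 0).
  - intros i Hi. unfold P at 1. rewrite <- conv_chain_atan_cauchy_moment_add, Rplus_assoc.
    unfold Q at 1. f_equal. unfold P. replace (d - i)%nat with (S (d - S i)) by lia.
    rewrite conv_chain_atan_moment_S, <- conv_plus_l.
    apply conv_ext; [|easy]. intros t. apply shifted_chain_S_S.
Qed.

Lemma is_lim_seq_cauchy_remainder d s : is_lim_seq (cauchy_remainder d s) 0.
Proof.
  apply (is_lim_seq_ext (fun n => (INR n + 1) * cauchy_remainder d s n / (INR n + 1))).
  - intros n. pose proof (pos_INR n). field. lra.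
  - apply (log_growth_div_lim (fun n => (INR n + 1) * cauchy_remainder d s n)).
    set (f := fun i t n => shifted_chain i n t *
      ((INR n + 1) * atan_cauchy_moment (2 * n - i) (d - i) (s - t))).
    apply (log_growth_ext
      (fun n => rsum (S d) (fun i => (-1) ^ i * rsum (S s) (fun t => f i t n)))).
    + intros n. unfold cauchy_remainder. rewrite <- lsum_scal. apply rsum_ext. intros i _.
      unfold conv, f. rewrite <- !lsum_scal. apply rsum_ext. intros; ring.
    + apply (log_growth_lsum (fun i n => (-1) ^ i * rsum (S s) (fun t => f i t n))). intros i _.
      apply log_growth_mult; [apply log_growth_const|]. apply (log_growth_lsum (f i)). intros t _.
      apply log_growth_mult; [apply log_growth_shifted_chain|apply log_growth_atan_cauchy_moment].
Qed.

Lemma pow_m1_sq d : (-1) ^ d * (-1) ^ d = 1.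
Proof. rewrite <- Rpow_mult_distr, <- (pow1 d). f_equal. ring. Qed.

Lemma is_series_shifted_chain d s : is_series
  (fun n => (-1) ^ n * conv (shifted_chain d n) (geo_coef (2 * INR n + 1 - INR d)) s)
  ((-1) ^ d * (2 * atan_cauchy_moment 0 d s)).
Proof.
  rewrite <- cauchy_remainder_0, <- Rmult_assoc.
  apply (is_series_Rext (fun n => (-1) ^ d * 2 *
    ((-1) ^ n * (cauchy_remainder d s n + cauchy_remainder d s (S n))))).
  - intros n. rewrite cauchy_remainder_add_S.
    rewrite <- (Rmult_1_l ((-1) ^ n * conv _ _ s)), <- (pow_m1_sq d). field.
  - apply is_series_Rscal, is_series_alternating_telescope, is_lim_seq_cauchy_remainder.
Qed.

(** * The sums [W] *)

Lemma lsum_all_lists_S r B (f : list nat -> R) : lsum (map f (all_lists (S r) B)) =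
  rsum B (fun i => lsum (map (fun l => f (S i :: l)) (all_lists r B))).
Proof.
  simpl. rewrite lsum_flat_map, <- seq_shift, map_map.
  apply lsum_ext_in. intros i _. now rewrite map_map.
Qed.

Lemma in_all_lists r B l :
  In l (all_lists r B) <-> length l = r /\ List.Forall (fun x => (1 <= x <= B)%nat) l.
Proof.
  revert l. induction r as [|r IH]; intros l; simpl.
  - split; [intros [<-|[]]; auto|]. intros [H _]. left. symmetry. now apply length_zero_iff_nil.
  - rewrite in_flat_map. split.
    + intros [x [Hx Hl]]. apply in_map_iff in Hl. destruct Hl as [l' [<- Hl']].
      apply IH in Hl'. apply in_seq in Hx. simpl. destruct Hl' as [<- Hl'].
      split; [reflexivity|]. constructor; [lia|easy].
    + intros [Hlen Hall]. destruct l as [|x l]; [discriminate|].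
      inversion Hall; subst. exists x. split; [apply in_seq; lia|].
      apply in_map, IH. split; [|easy]. now inversion Hlen.
Qed.

Lemma NoDup_all_lists r B : NoDup (all_lists r B).
Proof.
  induction r as [|r IHr]; simpl; [repeat constructor; auto|].
  generalize (seq_NoDup B 1). generalize (seq 1 B). intros s Hs.
  induction Hs as [|x s Hx Hs IH]; simpl; [constructor|].
  apply NoDup_app; [|easy|].
  - apply FinFun.Injective_map_NoDup; [|easy]. intros l l' E. now inversion E.
  - intros l Hl Hl'. apply in_map_iff in Hl. destruct Hl as [l1 [<- _]].
    apply in_flat_map in Hl'. destruct Hl' as [y [Hy Hl']].
    apply in_map_iff in Hl'. destruct Hl' as [l2 [E _]]. inversion E; subst. contradiction.
Qed.

(* The bound [B] on the parts is immaterial as soon as it is at least [k - r + 1]. *)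
Definition compositions (B r k : nat) : list (list nat) :=
  filter (fun l => Nat.eqb (nsum l) k) (all_lists r B).

Lemma in_compositions B r k l : In l (compositions B r k) <->
  (length l = r /\ List.Forall (fun x => (1 <= x <= B)%nat) l) /\ nsum l = k.
Proof. unfold compositions. now rewrite filter_In, in_all_lists, Nat.eqb_eq. Qed.

Lemma in_compositions_length B r k l : In l (compositions B r k) -> length l = r.
Proof. intros H. now apply in_compositions in H. Qed.

Lemma in_compositions_pos B r k l : In l (compositions B r k) ->
  List.Forall (fun x => (1 <= x)%nat) l.
Proof.
  intros H. apply in_compositions in H. destruct H as [[_ H] _].
  eapply Forall_impl; [|exact H]. simpl. lia.
Qed.

Lemma nsum_rev l : nsum (rev l) = nsum l.
Proof. exact (Permutation_list_sum (Permutation_sym (Permutation_rev l))). Qed.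

Lemma nsum_ge_length l : List.Forall (fun x => (1 <= x)%nat) l -> (length l <= nsum l)%nat.
Proof. induction 1; simpl; lia. Qed.

Lemma Permutation_rev_compositions B r k :
  Permutation (compositions B r k) (map (@rev nat) (compositions B r k)).
Proof.
  assert (Hrev : forall l, In l (compositions B r k) -> In (rev l) (compositions B r k)).
  { intros l. rewrite !in_compositions, length_rev, nsum_rev.
    intros [[Hl Hb] Hk]. auto using Forall_rev. }
  assert (HN : NoDup (compositions B r k)) by apply NoDup_filter, NoDup_all_lists.
  apply NoDup_Permutation; [easy| |].
  - apply FinFun.Injective_map_NoDup; [|easy].
    intros l l' E. rewrite <- (rev_involutive l), E. apply rev_involutive.
  - intros l. rewrite in_map_iff. split.
    + intros Hl. exists (rev l). split; [apply rev_involutive|now apply Hrev].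
    + intros [l' [<- Hl']]. now apply Hrev.
Qed.

Lemma lsum_compositions_S B r t (f : list nat -> R) : (S r + t <= B)%nat ->
  lsum (map f (compositions B (S r) (S r + t))) =
  rsum (S t) (fun j => lsum (map (fun l => f (S j :: l)) (compositions B r (r + (t - j))))).
Proof.
  intros HB. unfold compositions at 1. rewrite lsum_filter, lsum_all_lists_S.
  rewrite (rsum_truncate B (S t)); [|lia|].
  - apply rsum_ext. intros j Hj. unfold compositions. rewrite lsum_filter.
    apply lsum_ext_in. intros l _. change (nsum (S j :: l)) with (S j + nsum l)%nat.
    destruct (Nat.eqb_spec (S j + nsum l) (S r + t)), (Nat.eqb_spec (nsum l) (r + (t - j)));
      (reflexivity || lia).
  - intros j Hj. apply lsum_eq_0. intros l Hl. apply in_all_lists in Hl. destruct Hl as [Hl Hp].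
    assert (Hn : (length l <= nsum l)%nat).
    { apply nsum_ge_length. eapply Forall_impl; [|exact Hp]. simpl. lia. }
    change (nsum (S j :: l)) with (S j + nsum l)%nat.
    destruct (Nat.eqb_spec (S j + nsum l) (S r + t)); [lia|reflexivity].
Qed.

Lemma Grev_S k l n : Grev (k :: l) (S n) =
  rsum n (fun i => Grev l (S i) * / (2 * INR i + 1 - INR (length l)) ^ k).
Proof.
  cbn [Grev]. rewrite fsum_rsum. replace (S (S n - 1) - 1)%nat with n by lia.
  apply rsum_ext. intros i _. change (length (k :: l)) with (S (length l)).
  change (1 + i)%nat with (S i). rewrite !S_INR. unfold Rdiv. do 3 f_equal. ring.
Qed.

Lemma shifted_chain_compositions r t n B : (r + t <= B)%nat ->
  shifted_chain r n t = 2 ^ r * lsum (map (fun l => Grev l (S n)) (compositions B r (r + t))).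
Proof.
  revert t n. induction r as [|r IH]; intros t n HB; [destruct t; simpl; ring|].
  set (x := fun i => 2 * INR i + 1 - INR r). rewrite lsum_compositions_S by easy.
  transitivity (rsum (S t) (fun j => rsum n (fun i =>
    geo_coef (x i) j * shifted_chain r i (t - j)))).
  - rewrite (lsum_swap (fun j i => geo_coef (x i) j * shifted_chain r i (t - j))).
    cbn [shifted_chain]. apply rsum_ext. intros i _. apply conv_comm.
  - rewrite <- lsum_scal. apply rsum_ext. intros j Hj.
    rewrite (lsum_ext_in (fun l => Grev (S j :: l) (S n))
      (fun l => rsum n (fun i => / x i ^ S j * Grev l (S i)))).
    + rewrite (lsum_swap (fun l i => / x i ^ S j * Grev l (S i))), <- lsum_scal.
      apply rsum_ext. intros i _. rewrite lsum_scal, IH by lia.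
      unfold geo_coef, Rdiv. rewrite <- (tech_pow_Rmult 2). ring.
    + intros l Hl. apply in_compositions_length in Hl. rewrite Grev_S, Hl.
      apply rsum_ext. intros i _. apply Rmult_comm.
Qed.

Lemma log_regular_Grev l : List.Forall (fun x => (1 <= x)%nat) l ->
  log_regular (fun n => Grev l (S n)).
Proof.
  induction 1 as [|k l Hk Hl IH]; [apply (log_regular_const 1)|].
  destruct k as [|k]; [lia|].
  apply (log_regular_ext _ _ (fun n => eq_sym (Grev_S (S k) l n))).
  now apply log_regular_partial_sums, log_regular_log_growth,
    log_regular_mult_inv_shift_pow.
Qed.

Lemma ex_series_Grev l k : List.Forall (fun x => (1 <= x)%nat) l ->
  ex_series (fun n => (-1) ^ n * (Grev l (S n) * / (2 * INR n + 1 - INR (length l)) ^ S k)).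
Proof.
  intros Hl. set (f := fun n => Grev l (S n) * / (2 * INR n + 1 - INR (length l)) ^ S k).
  assert (Hf : forall n, (INR n + 1) * f n / (INR n + 1) = f n).
  { intros n. pose proof (pos_INR n). field. lra. }
  apply (ex_series_ext (fun n => (-1) ^ n * ((INR n + 1) * f n / (INR n + 1)))).
  - intros n. now rewrite Hf.
  - now apply log_regular_ex_series, log_regular_mult_inv_shift_pow,
      log_regular_Grev.
Qed.

(* [ks] lists the exponents from the outermost summation inwards, as in [Grev]. *)
Definition barT_term (ks : list nat) (n : nat) : R :=
  match ks with
  | nil => 0
  | k :: l => 2 ^ S (length l) * ((-1) ^ S n *
      (Grev l (S n) * / (2 * INR n + 1 - INR (length l)) ^ k))
  end.

Lemma is_series_barT_term ks : ks <> nil -> List.Forall (fun x => (1 <= x)%nat) ks ->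
  is_series (barT_term ks) (barT (rev ks)).
Proof.
  intros Hnil Hks. destruct Hks as [|k l Hk Hl]; [contradiction|]. destruct k as [|k]; [lia|].
  unfold barT. rewrite rev_involutive, length_rev. cbn [barT_term].
  apply is_series_Rscal.
  destruct (ex_series_Grev l k Hl) as [s Hs]. apply (is_series_Rscal (-1)) in Hs.
  set (f := fun n => (-1) ^ S n * (Grev l (S n) * / (2 * INR n + 1 - INR (length l)) ^ S k)).
  assert (Hf : is_series f (-1 * s)).
  { revert Hs. apply is_series_Rext. intros n. symmetry. apply Rmult_assoc. }
  rewrite (Series_ext _ f); [now rewrite (is_series_unique f _ Hf)|].
  intros n. cbv zeta. change (length (S k :: l)) with (S (length l)). rewrite !S_INR.
  replace (2 * (INR n + 1) - (INR (length l) + 1)) with (2 * INR n + 1 - INR (length l)) by ring.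
  unfold f, Rdiv. ring.
Qed.

Lemma lsum_barT_term_compositions d s n :
  lsum (map (fun ks => barT_term ks n) (compositions (S d + s) (S d) (S d + s))) =
  -1 * ((-1) ^ n * conv (shifted_chain d n) (geo_coef (2 * INR n + 1 - INR d)) s).
Proof.
  rewrite lsum_compositions_S, conv_comm by lia. unfold conv. rewrite <- !lsum_scal.
  apply rsum_ext. intros j Hj.
  rewrite (shifted_chain_compositions d (s - j) n (S d + s)) by lia.
  rewrite (lsum_ext_in _ (fun l => (-1) ^ S n * (2 ^ S d *
    / (2 * INR n + 1 - INR d) ^ S j) * Grev l (S n))).
  - rewrite lsum_scal. unfold geo_coef, Rdiv.
    rewrite <- (tech_pow_Rmult 2), <- (tech_pow_Rmult (-1)). ring.
  - intros l Hl. apply in_compositions_length in Hl. cbn [barT_term]. rewrite Hl. ring.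
Qed.

Lemma W_atan_cauchy_moment d s : W (S d + s) (S d) = - (-1) ^ d * (2 * atan_cauchy_moment 0 d s).
Proof.
  set (l := compositions (S d + s) (S d) (S d + s)).
  assert (HW : is_series (fun n => lsum (map (fun ks => barT_term ks n) l)) (W (S d + s) (S d))).
  { replace (W (S d + s) (S d)) with (lsum (map (fun ks => barT (rev ks)) l)).
    - apply is_series_lsum. intros ks Hks. apply is_series_barT_term.
      + intros ->. now apply in_compositions_length in Hks.
      + now apply in_compositions_pos in Hks.
    - rewrite <- (map_map (@rev nat) barT).
      apply lsum_permutation, Permutation_map, Permutation_sym, Permutation_rev_compositions. }
  assert (HQ : is_series (fun n => lsum (map (fun ks => barT_term ks n) l))
    (-1 * ((-1) ^ d * (2 * atan_cauchy_moment 0 d s)))).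
  { apply (is_series_Rext _ _ _ (fun n => eq_sym (lsum_barT_term_compositions d s n))).
    apply is_series_Rscal, is_series_shifted_chain. }
  rewrite <- (is_series_unique _ _ HW), (is_series_unique _ _ HQ). ring.
Qed.

(** * The matrix [Z] *)

Lemma last_cons (x d : nat) l : last (x :: l) d = last l x.
Proof.
  revert x d. induction l as [|y l IH]; intros x d; [reflexivity|].
  change (last (x :: y :: l) d) with (last (y :: l) d). now rewrite !IH.
Qed.

Definition zetabar_chain (p k j : nat) : R :=
  lsum (map (fun l => prod_diffs (fun d => zetabar (2 * d)) (j :: l))
    (filter (fun l => andb (incr (j :: l)) (Nat.eqb (last l j) p)) (all_lists k p))).

Lemma zetabar_chain_0 p j : zetabar_chain p 0 j = if Nat.eqb j p then 1 else 0.
Proof.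
  unfold zetabar_chain. rewrite lsum_filter. simpl. destruct (Nat.eqb j p); simpl; ring.
Qed.

Lemma zetabar_chain_S p k j : zetabar_chain p (S k) j =
  rsum p (fun i =>
    if Nat.ltb j (S i) then zetabar (2 * (S i - j)) * zetabar_chain p k (S i) else 0).
Proof.
  unfold zetabar_chain at 1. rewrite lsum_filter, lsum_all_lists_S. apply rsum_ext. intros i _.
  assert (Hincr : forall l, incr (j :: S i :: l) = andb (Nat.ltb j (S i)) (incr (S i :: l)))
    by reflexivity.
  destruct (Nat.ltb j (S i)).
  - unfold zetabar_chain. rewrite lsum_filter, <- lsum_scal. apply lsum_ext_in. intros l _.
    rewrite last_cons, Hincr. cbn [andb]. destruct (andb _ _); [reflexivity|ring].
  - apply lsum_eq_0. intros l _. now rewrite Hincr.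
Qed.

Lemma zetabar_chain_gt p k j : (p < j + k)%nat -> zetabar_chain p k j = 0.
Proof.
  revert j. induction k as [|k IH]; intros j H.
  - rewrite zetabar_chain_0. destruct (Nat.eqb_spec j p); [lia|reflexivity].
  - rewrite zetabar_chain_S. apply rsum_eq_0. intros i Hi.
    destruct (Nat.ltb_spec j (S i)); [|reflexivity]. rewrite IH by lia. ring.
Qed.

Lemma Zc_zetabar_chain j p n : (j <= p)%nat -> (p - j < n)%nat ->
  Zc j p = rsum n (fun k => (-2) ^ k * zetabar_chain p k j).
Proof.
  intros Hj Hn. rewrite (rsum_truncate n (S (p - j))); [|lia|].
  - rewrite rsum_S_l, zetabar_chain_0. unfold Zc. destruct (Nat.eqb_spec j p) as [->|Hne].
    + rewrite Nat.sub_diag, rsum_0. ring.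
    + rewrite fsum_rsum. replace (S (p - j) - 1)%nat with (p - j)%nat by lia.
      rewrite Rmult_0_r, Rplus_0_l. reflexivity.
  - intros i Hi. rewrite zetabar_chain_gt by lia. ring.
Qed.

Lemma Zc_rec p j : (j <= p)%nat -> Zc j p +
    rsum p (fun i => if Nat.ltb j (S i) then double_zetabar (2 * (S i - j)) * Zc (S i) p else 0) =
  if Nat.eqb j p then 1 else 0.
Proof.
  intros Hj. rewrite (Zc_zetabar_chain j p (S p)), rsum_S_l, zetabar_chain_0 by lia.
  set (f := fun k i => if Nat.ltb j (S i) then
    -1 * double_zetabar (2 * (S i - j)) * ((-2) ^ k * zetabar_chain p k (S i)) else 0).
  rewrite (rsum_ext p (fun i => (-2) ^ S i * _) (fun k => rsum p (f k))).
  2:{ intros k _. rewrite zetabar_chain_S, <- lsum_scal. apply rsum_ext. intros i _.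
      unfold f, double_zetabar. destruct (Nat.ltb j (S i)); [|ring].
      rewrite <- tech_pow_Rmult. ring. }
  rewrite lsum_swap, Rplus_assoc, <- lsum_plus, rsum_eq_0; [simpl; ring|].
  intros i Hi. unfold f. destruct (Nat.ltb j (S i)).
  - rewrite lsum_scal, (Zc_zetabar_chain (S i) p p) by lia. ring.
  - rewrite rsum_eq_0 by easy. ring.
Qed.

Lemma Zc_inverse b c : (c <= b)%nat ->
  rsum (S b) (fun q => if Nat.leb c q then double_zetabar (2 * (q - c)) * Zc (S q) (S b) else 0) =
  if Nat.eqb c b then 1 else 0.
Proof.
  intros Hc. change (Nat.eqb c b) with (Nat.eqb (S c) (S b)).
  rewrite <- (Zc_rec (S b) (S c)) by lia.
  rewrite <- (rsum_indicator (S b) c (fun q => Zc (S q) (S b))) by lia.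
  rewrite <- lsum_plus. apply rsum_ext. intros q Hq.
  change (Nat.ltb (S c) (S q)) with (Nat.ltb c q). simpl (S q - S c)%nat.
  destruct (Nat.leb_spec c q), (Nat.eqb_spec c q), (Nat.ltb_spec c q); try lia; try ring.
  subst. rewrite Nat.sub_diag, Nat.mul_0_r, double_zetabar_0. ring.
Qed.

Lemma conv_zetabar_Zc (f : nat -> R) b :
  rsum (S b) (fun q => Zc (S q) (S b) * conv f (fun d => double_zetabar (2 * d)) q) = f b.
Proof.
  set (z := fun c q => if Nat.leb c q then double_zetabar (2 * (q - c)) * Zc (S q) (S b) else 0).
  transitivity (rsum (S b) (fun q => rsum (S b) (fun c => f c * z c q))).
  - apply rsum_ext. intros q Hq. rewrite (rsum_truncate (S b) (S q)); [|lia|].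
    + unfold conv. rewrite <- lsum_scal. apply rsum_ext. intros c Hc.
      unfold z. destruct (Nat.leb_spec c q); [ring|lia].
    + intros c Hc. unfold z. destruct (Nat.leb_spec c q); [lia|ring].
  - rewrite lsum_swap. rewrite <- (rsum_indicator (S b) b f) by lia.
    apply rsum_ext. intros c Hc. unfold z. rewrite lsum_scal, Zc_inverse, Nat.eqb_sym by lia.
    destruct (Nat.eqb b c); ring.
Qed.

Lemma is_series_Tsum_mult a b :
  is_series (fun n => (-1) ^ n * (Tsum a (S n) * Tsum b (S n) / (2 * INR n + 1)))
    ((-1) ^ a * rsum (S b) (fun q => Zc (S q) (S b) * atan_cauchy_moment 0 (2 * a) (2 * q))).
Proof.
  set (c := fun n => conv (fun b => Tsum b (S n)) (fun d => double_zetabar (2 * d))).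
  rewrite <- lsum_scal.
  apply (is_series_Rext (fun n => rsum (S b) (fun q =>
    Zc (S q) (S b) * ((-1) ^ n * Tsum a (S n) * (c n q / (2 * INR n + 1)))))).
  - intros n. rewrite <- (conv_zetabar_Zc (fun b => Tsum b (S n)) b). fold (c n).
    transitivity ((-1) ^ n * Tsum a (S n) / (2 * INR n + 1) *
      rsum (S b) (fun q => Zc (S q) (S b) * c n q)); [|unfold Rdiv; ring].
    rewrite <- lsum_scal. apply rsum_ext. intros q _. unfold Rdiv. ring.
  - apply (is_series_lsum (fun q n => _ * ((-1) ^ n * Tsum a (S n) * (c n q / (2 * INR n + 1))))).
    intros q _. replace ((-1) ^ a * _) with
      (Zc (S q) (S b) * ((-1) ^ a * atan_cauchy_moment 0 (2 * a) (2 * q))) by ring.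
    apply is_series_Rscal, is_series_Tsum_moment.
Qed.

Theorem mainTheorem9 (m p : nat) (hm : (1 <= m)%nat) (hp : (1 <= p)%nat) :
  is_series
    (fun n0 => let n := S n0 in
       2 * (Tsum (m - 1) n * Tsum (p - 1) n / (2 * INR n - 1) * (-1) ^ n))
    ((-1) ^ (m - 1) *
     fsum 1 p (fun j => W (2 * j + 2 * m - 3) (2 * m - 1) * Zc j p)).
Proof.
  destruct m as [|a]; [lia|]. destruct p as [|b]; [lia|].
  rewrite !Nat.sub_succ, !Nat.sub_0_r, fsum_rsum, Nat.sub_succ, Nat.sub_0_r.
  replace ((-1) ^ a * _) with (-2 * ((-1) ^ a *
    rsum (S b) (fun q => Zc (S q) (S b) * atan_cauchy_moment 0 (2 * a) (2 * q)))).
  - apply (is_series_Rext (fun n =>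
      -2 * ((-1) ^ n * (Tsum a (S n) * Tsum b (S n) / (2 * INR n + 1))))).
    + intros n. cbv zeta. replace (2 * INR (S n) - 1) with (2 * INR n + 1) by (rewrite S_INR; ring).
      simpl ((-1) ^ S n). unfold Rdiv. ring.
    + apply is_series_Rscal, is_series_Tsum_mult.
  - rewrite <- !lsum_scal. apply rsum_ext. intros q _.
    replace (2 * (1 + q) + 2 * S a - 3)%nat with (S (2 * a) + 2 * q)%nat by lia.
    replace (2 * S a - 1)%nat with (S (2 * a)) by lia.
    rewrite W_atan_cauchy_moment, pow_1_even. simpl (1 + q)%nat. ring.
Qed.
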